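(* As formal power series in $q$, $$U\big(\gamma(q^2)\delta(q)^2\big)=3\xi(q)^2-2\xi(q)^3.$$
   Context: Let $E(q)=\prod_{m\ge1}(1-q^m)$. Define $$\delta(q)=\frac{E(q^4)E(q^6)^2}{E(q)E(q^3)E(q^{12})},\quad \gamma(q)=\frac{E(q)^5E(q^2)^5E(q^6)^5}{E(q^3)^{15}},\quad \xi(q)=\frac{E(q^2)^5E(q^6)}{E(q)E(q^3)^5}.$$ $U$ is the operator on power series given by $U\left(\sum_n a_nq^n\right)=\sum_n a_{2n}q^n$. *)

(* Defs.v *)
From mathcomp Require Import all_boot all_order all_algebra.
Set Implicit Arguments. Unset Strict Implicit. Unset Printing Implicit Defensive.
Import Order.TTheory GRing.Theory Num.Theory.
Local Open Scope ring_scope.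

Definition fps := nat -> rat.

Definition fadd (f g : fps) : fps := fun n => f n + g n.
Definition fscale (c : rat) (f : fps) : fps := fun n => c * f n.
Definition fmul (f g : fps) : fps :=
  fun n => \sum_(i < n.+1) f i * g (n - i)%N.
Definition fone : fps := fun n => if n == 0%N then 1 else 0.
Fixpoint fpow (f : fps) (k : nat) : fps :=
  match k with 0%N => fone | k'.+1 => fmul f (fpow f k') end.

(* Multiplicative inverse of a power series f with f 0 <> 0:
   g 0 = 1/f0, g n = -(1/f0) * sum_{i=1}^n f i * g (n-i).
   finv_upto f n is the list [g 0; ...; g n]. *)
Fixpoint finv_upto (f : fps) (n : nat) : seq rat :=
  match n with
  | 0%N => [:: (f 0%N)^-1]
  | n'.+1 => let s := finv_upto f n' in
      rcons s (- (f 0%N)^-1 * \sum_(i < n'.+1) f i.+1 * nth 0 s (n' - i)%N)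
  end.
Definition finv (f : fps) : fps := fun n => nth 0 (finv_upto f n) n.

Definition fdilate (k : nat) (f : fps) : fps :=
  fun n => if (k %| n)%N then f (n %/ k)%N else 0.

(* E(q) = prod_{m>=1} (1 - q^m); its n-th coefficient is the n-th coefficient
   of the finite product prod_{m=1}^{n} (1 - q^m). *)
Definition E : fps :=
  fun n => (\prod_(m < n) (1 - 'X^(m.+1) : {poly rat}))`_n.

Definition Ek (k : nat) : fps := fdilate k E.

Definition U (f : fps) : fps := fun n => f (2 * n)%N.

Definition delta : fps :=
  fmul (fmul (Ek 4) (fpow (Ek 6) 2))
       (finv (fmul (fmul (Ek 1) (Ek 3)) (Ek 12))).
Definition gamma : fps :=
  fmul (fmul (fmul (fpow (Ek 1) 5) (fpow (Ek 2) 5)) (fpow (Ek 6) 5))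
       (finv (fpow (Ek 3) 15)).
Definition xi : fps :=
  fmul (fmul (fpow (Ek 2) 5) (Ek 6))
       (finv (fmul (Ek 1) (fpow (Ek 3) 5))).

(* Main.v *)
(** Write [f_k = E(q^k)] (the series [eu k]), [phi = \sum q^(n^2)] and [psi = \sum_(n >= 0) q^(n (n + 1) / 2)].
   Since [1 / f_1^2 = phi f_4^2 / f_2^5], the square of [delta] is
   [f_4^4 / (f_2^5 f_6) * phi(q) phi(q^3)], so everything reduces to the even part [F(q^2)] of
   [phi(q) phi(q^3)], for which the claim reads
     [F psi = X - 2 Y]  with  [X = (f_2 f_3^2 / (f_1 f_6))^3]  and  [Y = q psi(q^3)^3].
   The odd part of [phi(q) phi(q^3)] is [2 q psi(q^2) psi(q^6)] (Legendre; a bijection between the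
   solutions of [s^2 + 3 t^2 = n] and those of [x^2 + 3 y^2 = 4 n]).  Multiplying the even and odd
   parts' sum by its image under [q |-> - q], which is a product of [f_k]s, gives
     [F^2 = 4 q psi(q)^2 psi(q^3)^2 + f_1^4 f_3^4 / (f_2^2 f_6^2)].
   It remains to see that the right-hand side times [psi^2] is [(X - 2 Y)^2]; this follows from
     [X + Y = f_2^8 f_3 / (f_1^4 f_6^2)]  and  [X - 8 Y = f_1^5 f_6 / (f_2 f_3^2)].
   These two are obtained by taking the product over the cube roots of unity [w] of the
   substitutions [q |-> w q] in the 3-dissections of [\sum_k z^k q^(k (k + 1) / 2)] at [z = 1] and
   at a primitive cube root of unity [z]; the theta series themselves are evaluated by Jacobi's
   triple product. *)

Require Import Defs.
From HB Require Import structures.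
From mathcomp Require Import all_boot all_order all_algebra all_field.
From mathcomp Require Import boolp zify ring.
Set Implicit Arguments. Unset Strict Implicit. Unset Printing Implicit Defensive.
Import Order.TTheory GRing.Theory Num.Theory.
Local Open Scope ring_scope.

(** * Formal power series *)

(** A name of its own for [nat -> R], to carry the ring structure of the Cauchy product. At [rat] it
    unfolds to [fps], so the series of the statement are elements of this ring. *)
Definition series (R : Type) : Type := nat -> R.
HB.instance Definition _ (R : Type) := gen_eqMixin (series R).
HB.instance Definition _ (R : Type) := gen_choiceMixin (series R).

Section SeriesZmodule.
Variable R : zmodType.
Implicit Types f g h : series R.
Definition series_zero : series R := fun _ => 0.
Definition series_add f g : series R := fun n => f n + g n.
Definition series_opp f : series R := fun n => - f n.
Fact series_addA : associative series_add.
Proof. by move=> f g h; apply/funext => n; apply: addrA. Qed.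
Fact series_addC : commutative series_add.
Proof. by move=> f g; apply/funext => n; apply: addrC. Qed.
Fact series_add0 : left_id series_zero series_add.
Proof. by move=> f; apply/funext => n; apply: add0r. Qed.
Fact series_addN : left_inverse series_zero series_opp series_add.
Proof. by move=> f; apply/funext => n; apply: addNr. Qed.
HB.instance Definition _ := GRing.isZmodule.Build (series R)
  series_addA series_addC series_add0 series_addN.
End SeriesZmodule.

Section SeriesRing.
Variable R : fieldType.
Implicit Types (f g h : series R) (p : {poly R}) (n N : nat).

Definition trunc N f : {poly R} := \poly_(i < N) f i.
Definition series_one : series R := fun n => if n == 0%N then 1 else 0.
Definition series_mul f g : series R :=
  fun n => \sum_(i < n.+1) f i * g (n - i)%N.

Lemma coef_trunc N f n : (n < N)%N -> (trunc N f)`_n = f n.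
Proof. by rewrite coef_poly => ->. Qed.

(** Only coefficients up to [n] enter, so [f] and [g] may be replaced by polynomials; associativity
    and commutativity are inherited from [{poly R}] in this way. *)
Lemma series_mul_coef (p q : {poly R}) f g n :
  (forall i, (i <= n)%N -> p`_i = f i) -> (forall i, (i <= n)%N -> q`_i = g i) ->
  series_mul f g n = (p * q)`_n.
Proof.
move=> hp hq; rewrite coefM; apply: eq_bigr => i _.
by rewrite hp ?hq ?leq_subr // -ltnS.
Qed.

Lemma series_mul_trunc f g n N : (n < N)%N ->
  series_mul f g n = (trunc N f * trunc N g)`_n.
Proof.
by move=> nN; apply: series_mul_coef => i ni; rewrite coef_trunc //; apply: leq_ltn_trans nN.
Qed.

Fact series_mulA : associative series_mul.
Proof.
move=> f g h; apply/funext => n; pose t := trunc n.+1.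
rewrite (@series_mul_coef (t f) (t g * t h)); last 2 first.
- by move=> i ni; rewrite coef_trunc.
- by move=> i ni; rewrite (@series_mul_trunc _ _ _ n.+1).
rewrite (@series_mul_coef (t f * t g) (t h)) ?mulrA // => i ni; last by rewrite coef_trunc.
by rewrite (@series_mul_trunc _ _ _ n.+1).
Qed.
Fact series_mulC : commutative series_mul.
Proof.
by move=> f g; apply/funext => n; rewrite !(@series_mul_trunc _ _ _ n.+1) // mulrC.
Qed.
Fact series_mul1 : left_id series_one series_mul.
Proof.
move=> f; apply/funext => n; rewrite /series_mul big_ord_recl /= subn0 mul1r.
by rewrite big1 ?addr0 // => i _; rewrite mul0r.
Qed.
Fact series_mulDl : left_distributive series_mul +%R.
Proof.
move=> f g h; apply/funext => n; rewrite /series_mul -[RHS]big_split /=.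
by apply: eq_bigr => i _; rewrite -mulrDl.
Qed.
Fact series_one_neq0 : series_one != 0.
Proof. by apply/eqP => /(congr1 (@^~ 0%N)) /eqP; rewrite oner_eq0. Qed.
HB.instance Definition _ := GRing.Zmodule_isComNzRing.Build (series R)
  series_mulA series_mulC series_mul1 series_mulDl series_one_neq0.

Lemma coef_add f g n : (f + g) n = f n + g n. Proof. by []. Qed.
Lemma coef_opp f n : (- f) n = - f n. Proof. by []. Qed.
Lemma coef_one n : (1 : series R) n = (n == 0%N)%:R.
Proof. by rewrite /GRing.one /= /series_one; case: eqP. Qed.
Lemma coef_mul f g n : (f * g) n = \sum_(i < n.+1) f i * g (n - i)%N.
Proof. by []. Qed.
Lemma coef_sum I (r : seq I) (P : pred I) (F : I -> series R) n :
  (\sum_(i <- r | P i) F i) n = \sum_(i <- r | P i) F i n.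
Proof. by elim/big_rec2: _ => // i x f _ <-. Qed.
Lemma coef_mul0 f g : (f * g) 0%N = f 0%N * g 0%N.
Proof. by rewrite coef_mul big_ord1. Qed.

Definition series_unit : {pred series R} := fun f => `[< exists g, g * f = 1 >].
Definition series_inv f : series R :=
  if pselect (exists g, g * f = 1) is left e then projT1 (cid e) else f.
Fact series_mulV : {in series_unit, left_inverse 1 series_inv *%R}.
Proof.
move=> f /asboolP uf; rewrite /series_inv; case: pselect => // e.
by case: (cid e).
Qed.
Fact series_unitP f g : g * f = 1 -> series_unit f.
Proof. by move=> gf; apply/asboolP; exists g. Qed.
Fact series_inv_out : {in [predC series_unit], series_inv =1 id}.
Proof.
move=> f; rewrite inE => /asboolPn nf; rewrite /series_inv.
by case: pselect.
Qed.
HB.instance Definition _ := GRing.ComNzRing_hasMulInverse.Build (series R)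
  series_mulV series_unitP series_inv_out.

Lemma series_neq0_ord f : f != 0 -> exists n, f n != 0 /\ forall i, (i < n)%N -> f i = 0.
Proof.
move=> f0; have ex : exists n, f n != 0.
  apply: contrapT => nex; move/eqP: f0; apply; apply/funext => n.
  by apply/eqP; apply: contrapT => fn; apply: nex; exists n; apply/negP.
case: (ex_minnP ex) => n fn nmin; exists n; split => // i ilt.
by apply/eqP; apply: contraLR ilt => fi; rewrite -leqNgt nmin.
Qed.

(** The lowest nonzero coefficients multiply. Working in a domain lets denominators be cleared and
    cancelled throughout. *)
Fact series_integral f g : f * g = 0 -> (f == 0) || (g == 0).
Proof.
move=> fg; apply/norP => -[] /series_neq0_ord [m [fm mmin]] /series_neq0_ord [n [gn nmin]].
have : (f * g) (m + n)%N = f m * g n.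
  have mlt : (m < (m + n).+1)%N by lia.
  rewrite coef_mul (bigD1 (Ordinal mlt)) //= addKn big1 ?addr0 // => i /eqP im.
  case: (ltngtP i m) => [/mmin -> | lt | e]; rewrite ?mul0r //.
    by rewrite nmin ?mulr0 //; have := ltn_ord i; lia.
  by case: im; apply: val_inj.
by move/eqP; rewrite fg eq_sym mulf_eq0 (negbTE fm) (negbTE gn).
Qed.
HB.instance Definition _ := GRing.ComUnitRing_isIntegral.Build (series R) series_integral.

Lemma coef_exp0 f k : (f ^+ k) 0%N = f 0%N ^+ k.
Proof. by elim: k => [|k IH]; rewrite ?expr0 // !exprS coef_mul0 IH. Qed.
End SeriesRing.

(** * Congruence modulo powers of q, limits and substitutions *)

Section Truncation.
Variable R : fieldType.
Implicit Types (f g h : series R) (n m N M k : nat).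

Definition eqm N f g := forall n, (n < N)%N -> f n = g n.

Lemma eqm_refl N f : eqm N f f. Proof. by []. Qed.
Lemma eqm_sym N f g : eqm N f g -> eqm N g f.
Proof. by move=> fg n nN; rewrite fg. Qed.
Lemma eqm_trans N g f h : eqm N f g -> eqm N g h -> eqm N f h.
Proof. by move=> fg gh n nN; rewrite fg ?gh. Qed.
Lemma eqm_le M N f g : (M <= N)%N -> eqm N f g -> eqm M f g.
Proof. by move=> MN fg n nM; apply/fg/leq_trans/MN. Qed.
Lemma eqmD N f f' g g' : eqm N f f' -> eqm N g g' -> eqm N (f + g) (f' + g').
Proof. by move=> hf hg n nN; rewrite !coef_add hf ?hg. Qed.
Lemma eqmN N f f' : eqm N f f' -> eqm N (- f) (- f').
Proof. by move=> hf n nN; rewrite !coef_opp hf. Qed.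
Lemma eqmM N f f' g g' : eqm N f f' -> eqm N g g' -> eqm N (f * g) (f' * g').
Proof.
move=> hf hg n nN; rewrite !coef_mul; apply: eq_bigr => i _.
by rewrite hf ?hg // ?(leq_ltn_trans (leq_subr _ _)) // (leq_ltn_trans _ nN) // -ltnS.
Qed.
Lemma eqm_sum N I (r : seq I) (P : pred I) (F G : I -> series R) :
  (forall i, P i -> eqm N (F i) (G i)) ->
  eqm N (\sum_(i <- r | P i) F i) (\sum_(i <- r | P i) G i).
Proof. by move=> FG; apply: big_ind2 => // *; apply: eqmD. Qed.
(** A factor divisible by [q ^ M] adds [M] to the precision of the other factor. *)
Lemma eqmMo M N f g g' : eqm M f 0 -> eqm N g g' -> eqm (M + N) (f * g) (f * g').
Proof.
move=> hf hg n nN; rewrite !coef_mul; apply: eq_bigr => i _.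
case: (ltnP i M) => iM; first by rewrite hf // !mul0r.
by rewrite hg //; have := ltn_ord i; lia.
Qed.
Lemma eqm_ext f g : (forall N, eqm N f g) -> f = g.
Proof. by move=> fg; apply/funext => n; apply: (fg n.+1). Qed.

(** The monomial [c q ^ m]; [mono c 0] serves as the constant [c]. *)
Definition mono (c : R) m : series R := fun n => c *+ (n == m).

Lemma mono_coef c m f n : (m <= n)%N -> (mono c m * f) n = c * f (n - m)%N.
Proof.
move=> mn; rewrite coef_mul (bigD1 (Ordinal (mn : (m < n.+1)%N))) //= big1.
  by rewrite /mono eqxx addr0.
move=> i im; rewrite /mono; case: eqP => [e|]; last by rewrite mul0r.
by case/eqP: im; apply: val_inj.
Qed.
Lemma mono_coef_lt c m f n : (n < m)%N -> (mono c m * f) n = 0.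
Proof.
move=> nm; rewrite coef_mul big1 // => i _; rewrite /mono.
by case: eqP => [e|]; rewrite ?mul0r //; have := ltn_ord i; lia.
Qed.
Lemma mono_mul a m b n : mono a m * mono b n = mono (a * b) (m + n).
Proof.
apply/funext => k; case: (ltnP k m) => km.
  by rewrite mono_coef_lt // /mono; case: eqP => //; lia.
rewrite mono_coef // /mono mulrnAr; congr (_ *+ _).
by congr nat_of_bool; apply/eqP/eqP; lia.
Qed.
Lemma mono1 : mono 1 0 = 1.
Proof. by apply/funext => n; rewrite coef_one. Qed.
Lemma mono_eqm0 c m : eqm m (mono c m) 0.
Proof. by move=> n nm; rewrite /mono; case: eqP => //; lia. Qed.
Lemma monoX m k : mono 1 m ^+ k = mono 1 (m * k).
Proof.
elim: k => [|k IH]; first by rewrite muln0 mono1.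
by rewrite exprS IH mono_mul mul1r mulnS.
Qed.

(** Geometric series in [h = 1 - f]: since [h] has no constant term, [h ^+ i] is divisible by
    [q ^ i], and the coefficient of index [n] only needs [i <= n]. *)
Lemma series_unit1 f : f 0%N = 1 -> f \is a GRing.unit.
Proof.
move=> f0; pose h := 1 - f; have h0 : h 0%N = 0 by rewrite /h coef_add coef_opp coef_one f0 subrr.
have hX N : eqm N (h ^+ N) 0.
  elim: N => // N IH; rewrite exprS -[N.+1]add1n.
  apply: eqm_trans (eqmMo _ IH) _; last by rewrite mulr0.
  by case.
pose g : series R := fun n => (\sum_(i < n.+1) h ^+ i) n.
have gS N : eqm N g (\sum_(i < N) h ^+ i).
  move=> n nN; rewrite /g -(subnK nN); elim: (N - n.+1)%N => // k ->.
  by rewrite addSn big_ord_recr /= coef_add hX ?addr0 //; lia.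
apply/unitrP; exists g; suff gf : g * f = 1 by rewrite [f * g]mulrC gf.
apply: eqm_ext => N; apply: eqm_trans (eqmM (gS N) (eqm_refl _)) _.
have -> : (\sum_(i < N) h ^+ i) * f = 1 - h ^+ N.
  by rewrite -(expr1n _ N) subrXX subKr mulrC; congr (_ * _); apply: eq_bigr => i _; rewrite expr1n mul1r.
by rewrite -[X in eqm _ _ X]subr0; apply: eqmD => //; apply: eqmN.
Qed.

Lemma eqmV N f g : f \is a GRing.unit -> g \is a GRing.unit ->
  eqm N f g -> eqm N f^-1 g^-1.
Proof.
move=> uf ug fg; rewrite -[f^-1](mulrK ug) -[X in eqm _ _ X]mul1r -(mulVr uf) -!mulrA.
by apply: eqmM => //; apply: eqmM => //; apply: eqm_sym.
Qed.

(** Convergence for the [q]-adic topology. Identities of infinite products are checked on finite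
    products and passed to the limit by [cvgs_uniq]. *)
Definition cvgs (s : nat -> series R) f :=
  forall N, exists M0, forall M, (M0 <= M)%N -> eqm N (s M) f.

Lemma cvgs_uniq s f g : cvgs s f -> cvgs s g -> f = g.
Proof.
move=> sf sg; apply: eqm_ext => N; have [A hA] := sf N; have [B hB] := sg N.
apply: (@eqm_trans _ (s (maxn A B))); last by apply: hB; apply: leq_maxr.
by apply: eqm_sym; apply: hA; apply: leq_maxl.
Qed.
Lemma cvgs_eqm s f : (forall M, eqm M (s M) f) -> cvgs s f.
Proof. by move=> sf N; exists N => M NM; apply: eqm_le NM _. Qed.
Lemma cvgs_cst f : cvgs (fun=> f) f. Proof. by apply: cvgs_eqm. Qed.
Lemma cvgsM s t f g : cvgs s f -> cvgs t g -> cvgs (fun M => s M * t M) (f * g).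
Proof.
move=> sf tg N; have [A hA] := sf N; have [B hB] := tg N.
by exists (maxn A B) => M; rewrite geq_max => /andP[/hA ? /hB ?]; apply: eqmM.
Qed.
Lemma cvgsD s t f g : cvgs s f -> cvgs t g -> cvgs (fun M => s M + t M) (f + g).
Proof.
move=> sf tg N; have [A hA] := sf N; have [B hB] := tg N.
by exists (maxn A B) => M; rewrite geq_max => /andP[/hA ? /hB ?]; apply: eqmD.
Qed.
Lemma cvgsX s f k : cvgs s f -> cvgs (fun M => s M ^+ k) (f ^+ k).
Proof.
move=> sf; elim: k => [|k IH]; first exact: cvgs_cst.
have -> : (fun M => s M ^+ k.+1) = (fun M => s M * s M ^+ k) by apply/funext => M; rewrite exprS.
by rewrite exprS; apply: cvgsM.
Qed.
Lemma cvgs_sub s f (h : nat -> nat) : (forall M, (M <= h M)%N) ->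
  cvgs s f -> cvgs (fun M => s (h M)) f.
Proof. by move=> hM sf N; have [A hA] := sf N; exists A => M AM; apply/hA/leq_trans/hM. Qed.
Lemma cvgs_map (T : series R -> series R) s f :
  (forall N g h, eqm N g h -> eqm N (T g) (T h)) ->
  cvgs s f -> cvgs (fun M => T (s M)) (T f).
Proof. by move=> hT sf N; have [A hA] := sf N; exists A => M /hA; apply: hT. Qed.

Definition ofpoly (p : {poly R}) : series R := fun n => p`_n.
Fact ofpoly_additive : zmod_morphism ofpoly.
Proof. by move=> p q; apply/funext => n; rewrite /ofpoly coefB. Qed.
Fact ofpoly_multiplicative : monoid_morphism ofpoly.
Proof.
split=> [|p q]; apply/funext => n; first by rewrite /ofpoly coef1 coef_one.
by rewrite /ofpoly coefM.
Qed.
HB.instance Definition _ := GRing.isZmodMorphism.Build _ _ ofpoly ofpoly_additive.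
HB.instance Definition _ := GRing.isMonoidMorphism.Build _ _ ofpoly ofpoly_multiplicative.
Lemma ofpolyXn n : ofpoly 'X^n = mono 1 n.
Proof. by apply/funext => m; rewrite /ofpoly coefXn. Qed.

(* The step is [k.-1.+1] so that [dil k] is a ring morphism for every [k], being
   the identity for [k = 0]. *)
Definition dil k f : series R :=
  fun n => if (k.-1.+1 %| n)%N then f (n %/ k.-1.+1)%N else 0.

Lemma eqm_dil k N f g : eqm N f g -> eqm N (dil k f) (dil k g).
Proof.
move=> fg n nN; rewrite /dil; case: ifP => // _; apply: fg.
by apply: leq_ltn_trans nN; apply: leq_div.
Qed.
Lemma dil_comp_poly k (p : {poly R}) : dil k (ofpoly p) = ofpoly (p \Po 'X^(k.-1.+1)).
Proof. by apply/funext => n; rewrite /dil /ofpoly coef_comp_poly_Xn. Qed.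
Lemma eqm_trunc N f : eqm N f (ofpoly (trunc N f)).
Proof. by move=> n nN; rewrite /ofpoly coef_trunc. Qed.
Fact dil_additive k : zmod_morphism (dil k).
Proof.
move=> f g; apply/funext => n; rewrite !(coef_add, coef_opp) /dil.
by case: ifP; rewrite ?subr0.
Qed.
Fact dil_multiplicative k : monoid_morphism (dil k).
Proof.
split=> [|f g]; apply: eqm_ext => N.
  by rewrite -(rmorph1 ofpoly) dil_comp_poly -polyC1 comp_polyC.
have h := @eqm_trunc N; apply: eqm_trans (eqm_dil k (eqmM (h f) (h g))) _.
rewrite -rmorphM dil_comp_poly comp_polyM rmorphM /= -!dil_comp_poly.
by apply: eqmM; apply/eqm_dil/eqm_sym.
Qed.
HB.instance Definition _ k := GRing.isZmodMorphism.Build _ _ (dil k) (@dil_additive k).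
HB.instance Definition _ k := GRing.isMonoidMorphism.Build _ _ (dil k) (@dil_multiplicative k).

Lemma dil_mono k c m : dil k.+1 (mono c m) = mono c (k.+1 * m).
Proof.
apply/funext => n; rewrite /dil /mono /=; case: ifP => [/dvdnP[j ->]|kn].
  by rewrite mulnK // mulnC eqn_pmul2l.
by case: eqP => // e; move: kn; rewrite e dvdn_mulr.
Qed.
Lemma dil_dil j k f : dil j.+1 (dil k.+1 f) = dil (j.+1 * k.+1) f.
Proof.
apply/funext => n; rewrite /dil [((_ * _)%N).-1.+1]prednK ?muln_gt0 //=.
case: ifP => jn; last by case: ifP => // /(dvdn_trans (dvdn_mulr _ (dvdnn _))); rewrite jn.
by rewrite dvdn_divRL // [(k.+1 * _)%N]mulnC divnMA.
Qed.
Lemma dil1 f : dil 1 f = f.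
Proof. by apply/funext => n; rewrite /dil dvd1n divn1. Qed.
Lemma dil_inj k : injective (dil k).
Proof.
move=> f g /(congr1 (fun h : series R => fun n => h (n * k.-1.+1)%N)) e.
apply/funext => n; have := congr1 (@^~ n) e.
by rewrite /dil dvdn_mull // mulnK.
Qed.
Lemma dil_coef0 k f : dil k f 0%N = f 0%N.
Proof. by rewrite /dil dvdn0 div0n. Qed.

(** The substitution [q |-> z q]. *)
Definition twist (z : R) f : series R := fun n => z ^+ n * f n.
Lemma eqm_twist z N f g : eqm N f g -> eqm N (twist z f) (twist z g).
Proof. by move=> fg n nN; rewrite /twist fg. Qed.
Fact twist_additive z : zmod_morphism (twist z).
Proof. by move=> f g; apply/funext => n; apply: mulrBr. Qed.
Fact twist_multiplicative z : monoid_morphism (twist z).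
Proof.
split=> [|f g]; apply/funext => n; rewrite /twist.
  by rewrite coef_one; case: n => [|n]; rewrite ?mulr1 ?mulr0.
rewrite !coef_mul mulr_sumr; apply: eq_bigr => i _.
by rewrite mulrACA -exprD subnKC // -ltnS.
Qed.
HB.instance Definition _ z := GRing.isZmodMorphism.Build _ _ (twist z) (@twist_additive z).
HB.instance Definition _ z := GRing.isMonoidMorphism.Build _ _ (twist z) (@twist_multiplicative z).
Lemma twist_mono z c m : twist z (mono c m) = mono (z ^+ m * c) m.
Proof. by apply/funext => n; rewrite /twist /mono mulrnAr; case: eqP => [->|]. Qed.
Lemma twist_dil z k f : twist z (dil k.+1 f) = dil k.+1 (twist (z ^+ k.+1) f).
Proof.
apply/funext => n; rewrite /twist /dil /=; case: ifP => [/divnK e|]; rewrite ?mulr0 //.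
by rewrite -exprM mulnC e.
Qed.
Lemma twist1 f : twist 1 f = f.
Proof. by apply/funext => n; rewrite /twist expr1n mul1r. Qed.

Definition eulerp M : series R := \prod_(i < M) (1 - mono 1 i.+1).
(** Same body as [E], so that over [rat] the series [Ek k] and [dil k euler] are convertible for
    each positive numeral [k]. *)
Definition euler : series R :=
  fun n => (\prod_(m < n) (1 - 'X^(m.+1) : {poly R}))`_n.

Lemma eulerp_poly M : eulerp M = ofpoly (\prod_(m < M) (1 - 'X^(m.+1))).
Proof.
by rewrite rmorph_prod; apply: eq_bigr => i _; rewrite rmorphB rmorph1 /= ofpolyXn.
Qed.
Lemma eulerp_eqm M : eqm M.+1 (eulerp M) euler.
Proof.
move=> n nM; transitivity (eulerp n n); last by rewrite eulerp_poly.
rewrite -(subnK (nM : (n <= M)%N)); elim: (M - n)%N => // k IH.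
rewrite addSn -IH /eulerp big_ord_recr /= -[in RHS](mulr1 (\prod_(_ < _) _)).
apply: (@eqmM n.+1) => //; rewrite -[X in eqm _ _ X]subr0.
apply: eqmD => //; apply: eqmN; apply: eqm_le (@mono_eqm0 _ _); lia.
Qed.
Lemma euler_cvg : cvgs eulerp euler.
Proof. by apply: cvgs_eqm => M; apply: eqm_le (leqnSn _) (@eulerp_eqm M). Qed.
Lemma euler_dil_cvg k : cvgs (fun M => dil k (eulerp M)) (dil k euler).
Proof. by apply: cvgs_map euler_cvg; apply: eqm_dil. Qed.
Lemma eulerp0 M : eulerp M 0%N = 1.
Proof. by rewrite (@eulerp_eqm M) // /euler big_ord0 coef1. Qed.
Lemma euler0 : euler 0%N = 1. Proof. by rewrite /euler big_ord0 coef1. Qed.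
Lemma dil_eulerp k M : dil k.+1 (eulerp M) = \prod_(i < M) (1 - mono 1 (k.+1 * i.+1)).
Proof.
by rewrite rmorph_prod; apply: eq_bigr => i _; rewrite rmorphB rmorph1 /= dil_mono.
Qed.
End Truncation.

(** * Bilateral sums *)

Section SymmetricSums.
Variable V : zmodType.
Implicit Types (F G : int -> V) (M N : nat).

Definition isum N F : V := \sum_(i < 2 * N + 1) F (i%:Z - N%:Z).

Lemma isum_shift N F : isum N (fun k => F (k - 1)) + F N%:Z = isum N F + F (- N%:Z - 1).
Proof.
pose G (i : nat) := F (i%:Z - N%:Z - 1).
transitivity (\sum_(i < (2 * N + 1).+1) G i).
  by rewrite big_ord_recr /=; congr (_ + F _); lia.
rewrite big_ord_recl addrC /G /=; congr (_ + F _); last by lia.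
by apply: eq_bigr => i _; congr F; rewrite /= /bump; lia.
Qed.
Lemma isum_recr N F : isum N.+1 F = isum N F + F N.+1%:Z + F (- N.+1%:Z).
Proof.
rewrite /isum (_ : 2 * N.+1 + 1 = (2 * N + 1).+2)%N; last by lia.
rewrite big_ord_recr big_ord_recl /= [X in X + _]addrC addrAC.
congr (_ + F _ + F _); [|by lia..].
by apply: eq_bigr => i _; congr F; rewrite /bump; lia.
Qed.
Lemma isum0 F : isum 0 F = F 0. Proof. by rewrite /isum big_ord1. Qed.
Lemma eq_isum N F G : (forall k, (`|k| <= N)%N -> F k = G k) -> isum N F = isum N G.
Proof. by move=> FG; apply: eq_bigr => i _; apply: FG; have := ltn_ord i; lia. Qed.
Lemma isumD N F G : isum N (fun k => F k + G k) = isum N F + isum N G.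
Proof. exact: big_split. Qed.
Lemma isum_opp N F : isum N (fun k => F (- k)) = isum N F.
Proof. by elim: N => [|N IH]; rewrite ?isum0 // !isum_recr IH opprK addrAC. Qed.
(** The range [|k| <= 3 N + 1] is exactly the union of the triples centred at [3 k] with
    [|k| <= N]. *)
Lemma isum_mod3 N F :
  isum (3 * N).+1 F = isum N (fun k => F (3 * k - 1) + F (3 * k) + F (3 * k + 1)).
Proof.
elim: N => [|N IH]; first by rewrite muln0 isum_recr !isum0 mulr0 sub0r add0r [LHS]addrC addrA.
rewrite (_ : 3 * N.+1 = (3 * N).+3)%N; last by lia.
rewrite 3!isum_recr IH isum_recr.
have -> : (3 * N).+2 = 3 * N.+1%:Z - 1 :> int by lia.
have -> : (3 * N).+3 = 3 * N.+1%:Z :> int by lia.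
have -> : (3 * N).+4 = 3 * N.+1%:Z + 1 :> int by lia.
have -> : - (3 * N.+1%:Z - 1) = 3 * - N.+1%:Z + 1 by lia.
have -> : - (3 * N.+1%:Z + 1) = 3 * - N.+1%:Z - 1 by lia.
have -> : - (3 * N.+1%:Z) = 3 * - N.+1%:Z by lia.
by rewrite -!addrA; congr (_ + _); rewrite !addrA [LHS](ACl (1*3*5*6*4*2))%AC.
Qed.
End SymmetricSums.

(** The triangular number [k (k + 1) / 2] at an integer; both branches agree in form because it is
    invariant under [k |-> - 1 - k]. *)
Definition tri (k : int) : nat :=
  match k with Posz n => 'C(n.+1, 2) | Negz n => 'C(n.+1, 2) end.

Lemma triE k : (tri k)%:Z * 2 = k * (k + 1).
Proof.
have binE n : ('C(n.+1, 2) * 2 = n * n.+1)%N by elim: n => // n IH; rewrite binS bin1; nia.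
by case: k => n; rewrite /tri -[2]/(2%:Z) -PoszM binE; lia.
Qed.

(** * Jacobi's triple product *)

Section JacobiTripleProduct.
Variables (R : fieldType) (z : R) (s t : nat).
Hypotheses (z0 : z != 0) (s0 : (0 < s)%N).
Implicit Types (k : int) (M N : nat).
Let d := (s + t)%N.

Definition texp k : nat := (s * tri k + t * tri (- k))%N.
(** The general term [a ^ (k (k + 1) / 2) b ^ (k (k - 1) / 2)] of Ramanujan's theta series, at
    [a = z q ^ s] and [b = z^-1 q ^ t]. *)
Definition term k : series R := mono (z ^ k) (texp k).
Definition theta : series R := fun n => isum n.+1 term n.

Lemma texp2 k : (texp k)%:Z * 2 = s%:Z * (k * (k + 1)) + t%:Z * (k * (k - 1)).
Proof.
rewrite /texp PoszD !PoszM mulrDl -!mulrA !triE; congr (_ + _ * _).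
by rewrite mulNr -mulrN opprD opprK.
Qed.
Lemma texpS k : (texp (k + 1))%:Z = (texp k)%:Z + s%:Z * (k + 1) + t%:Z * k.
Proof.
have two : (2 : int) != 0 by [].
by apply: (mulIf two); rewrite !mulrDl !texp2; ring.
Qed.
(** This bound justifies the range [n.+1] in [theta]. The successor is due to [t = 0], where
    [k = -1] has exponent 0. *)
Lemma texp_ge k : (`|k| <= (texp k).+1)%N.
Proof.
clear z0; have := texp2 k; set e := texp k.
have up : 0 <= (s%:Z - 1) * (k * (k + 1)).
  by apply: mulr_ge0; [lia | nia].
have dn : 0 <= t%:Z * (k * (k - 1)) by apply: mulr_ge0; [lia | nia].
move=> h; have {up dn}h : k * (k + 1) <= e%:Z * 2 by lia.
by have [k0|k0] := lerP 0 k; nia.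
Qed.

Lemma theta_eqm M : eqm M (isum M term) theta.
Proof.
clear z0; move=> n nM; rewrite /theta.
have t0 j : (n.+1 < `|j|)%N -> term j n = 0.
  by move=> h; apply: (@mono_eqm0 _ _ (texp j)); have := texp_ge j; lia.
rewrite -(subnK nM); elim: (M - n.+1)%N => // k IH.
by rewrite addSn isum_recr !coef_add IH !t0 ?addr0 //; lia.
Qed.
Lemma theta_cvg : cvgs (fun M => isum M term) theta.
Proof. exact/cvgs_eqm/theta_eqm. Qed.

Definition qpoch M : series R := dil d (eulerp R M).
(* Extended by 0 to negative [k], so that [rpoch_rec] also holds for [j = 0]. *)
Definition rpoch k : series R := if k is Posz j then (qpoch j)^-1 else 0.
(* The Gaussian binomial coefficient of [2 M] over [M + k] in the base [q ^ d]. *)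
Definition gauss M k : series R := qpoch (2 * M) * rpoch (M%:Z + k) * rpoch (M%:Z - k).

Lemma d_gt0 : (0 < d)%N. Proof. by rewrite /d; lia. Qed.
Lemma qpochE M : qpoch M = \prod_(i < M) (1 - mono 1 (d * i.+1)).
Proof. by rewrite /qpoch; have := d_gt0; case: d => // d' _; rewrite dil_eulerp. Qed.
Lemma qpochS M : qpoch M.+1 = qpoch M * (1 - mono 1 (d * M.+1)).
Proof. by rewrite !qpochE big_ord_recr. Qed.
Lemma qpoch_unit M : qpoch M \is a GRing.unit.
Proof. by apply: series_unit1; rewrite /qpoch dil_coef0 eulerp0. Qed.
Lemma rpoch_rec j : rpoch (j%:Z - 1) = (1 - mono 1 (d * j)) * rpoch j%:Z.
Proof.
case: j => [|j]; first by rewrite muln0 mono1 subrr mul0r.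
have -> : j.+1%:Z - 1 = j%:Z by lia.
have := qpoch_unit j.+1; rewrite /= qpochS unitrM => /andP[u v].
by rewrite invrM // mulrA divrr // mul1r.
Qed.
Lemma gauss_out M k : (M < `|k|)%N -> gauss M k = 0.
Proof.
move=> Mk; rewrite /gauss; have [k0|k0] := lerP 0 k.
  have -> : M%:Z - k = Negz (`|k| - M).-1 by lia.
  by rewrite mulr0.
have -> : M%:Z + k = Negz (`|k| - M).-1 by lia.
by rewrite mulr0 mul0r.
Qed.

(** Two steps of the [q]-Pascal rule at once. With [a = M + 1 + k], [b = M + 1 - k] and [A], [B],
    [Q] the powers of [q ^ d] of exponents [a], [b], [2 M + 1], it reduces to [(1 - Q) (1 - A B) =
    (1 - A) (1 - B) (1 + Q) + (B - Q) (1 - A) + (A - Q) (1 - B)]. *)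
Lemma gauss_rec M k : (`|k| <= M.+1)%N ->
  gauss M.+1 k = gauss M k * (1 + mono 1 (d * (2 * M).+1))
    + gauss M (k - 1) * mono 1 (d * absz (M.+1%:Z - k))
    + gauss M (k + 1) * mono 1 (d * absz (M.+1%:Z + k)).
Proof.
move=> kM; pose a := absz (M.+1%:Z + k); pose b := absz (M.+1%:Z - k).
rewrite /gauss -/a -/b.
have -> : M.+1%:Z + k = a%:Z by lia.
have -> : M.+1%:Z - k = b%:Z by lia.
have -> : M%:Z + k = a%:Z - 1 by lia.
have -> : M%:Z - k = b%:Z - 1 by lia.
have -> : M%:Z + (k - 1) = a%:Z - 1 - 1 by lia.
have -> : M%:Z - (k - 1) = b%:Z by lia.
have -> : M%:Z + (k + 1) = a%:Z by lia.
have -> : M%:Z - (k + 1) = b%:Z - 1 - 1 by lia.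
(* The monomial is multiplied into the factor of index [j - 1], as [i + (j - 1) = 2 M + 1]; in this
   form the case [j = 0] is included, both sides being 0. *)
have rec2 j i : (i + j = (2 * M).+2)%N -> rpoch (j%:Z - 1 - 1) * mono 1 (d * i)
    = (mono 1 (d * i) - mono 1 (d * (2 * M).+1)) * (1 - mono 1 (d * j)) * rpoch j%:Z.
  case: j => [|j] ij; first by rewrite muln0 mono1 subrr mulr0 !mul0r.
  have -> : j.+1%:Z - 1 - 1 = j%:Z - 1 by lia.
  rewrite rpoch_rec (_ : j%:Z = j.+1%:Z - 1); last by lia.
  rewrite rpoch_rec (_ : mono 1 (d * (2 * M).+1) = mono 1 (d * i) * mono 1 (d * j)); first by ring.
  by rewrite mono_mul mulr1 -mulnDr; congr (mono 1 (d * _)); lia.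
have ab : (a + b = (2 * M).+2)%N by lia.
rewrite (_ : qpoch (2 * M) * rpoch (a%:Z - 1 - 1) * rpoch b%:Z * mono 1 (d * b)
  = qpoch (2 * M) * rpoch b%:Z * (rpoch (a%:Z - 1 - 1) * mono 1 (d * b))); last by ring.
rewrite (_ : qpoch (2 * M) * rpoch a%:Z * rpoch (b%:Z - 1 - 1) * mono 1 (d * a)
  = qpoch (2 * M) * rpoch a%:Z * (rpoch (b%:Z - 1 - 1) * mono 1 (d * a))); last by ring.
rewrite !rec2 ?[(b + a)%N]addnC // !rpoch_rec.
have -> : (2 * M.+1 = (2 * M).+2)%N by lia.
rewrite !qpochS (_ : mono 1 (d * (2 * M).+2) = mono 1 (d * a) * mono 1 (d * b)); first by ring.
by rewrite mono_mul mulr1 -mulnDr ab.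
Qed.

(** By induction: the two new factors multiply the sum by [1 + q ^ (d (2 M + 1))] plus two terms
    that shift [k] by one, and [gauss_rec] compares the coefficients. *)
Lemma finite_triple_product M :
  \prod_(i < M) ((1 + mono z (s + d * i)) * (1 + mono z^-1 (t + d * i)))
  = isum M (fun k => gauss M k * term k).
Proof.
elim: M => [|M IH].
  have q0 : qpoch 0 = 1 by rewrite qpochE big_ord0.
  rewrite big_ord0 isum0 /gauss muln0 oppr0 !addr0 /= q0 invr1 !mul1r.
  by rewrite /term /texp oppr0 expr0z (_ : tri 0 = 0%N) // !muln0 mono1.
rewrite big_ord_recr /= IH.
have up k : (`|k| <= M)%N -> term k * mono z (s + d * M) = term (k + 1) * mono 1 (d * absz (M%:Z - k)).
  move=> kM; rewrite /term !mono_mul mulr1 exprzDr ?unitfE // expr1z; congr (mono _ _).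
  have := texpS k; rewrite /d; nia.
have dn k : (`|k| <= M)%N -> term k * mono z^-1 (t + d * M) = term (k - 1) * mono 1 (d * absz (M%:Z + k)).
  move=> kM; rewrite /term !mono_mul mulr1 exprzDr ?unitfE // exprN1; congr (mono _ _).
  have := texpS (k - 1); rewrite subrK /d; nia.
pose G k := gauss M k * term k.
have ext F : (forall k, (M < `|k|)%N -> F k = 0) -> isum M F = isum M.+1 F :> series R.
  by move=> F0; rewrite isum_recr (F0 M.+1) ?(F0 (- M.+1%:Z)) ?addr0 // abszN.
pose A k := gauss M k * (term k * mono z (s + d * M)).
pose B k := gauss M k * (term k * mono z^-1 (t + d * M)).
have -> : isum M G * ((1 + mono z (s + d * M)) * (1 + mono z^-1 (t + d * M))) =
   isum M (fun k => G k * (1 + mono 1 (d * (2 * M).+1))) + isum M A + isum M B.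
  rewrite /isum !mulr_suml -!big_split /=; apply: eq_bigr => i _; rewrite /G /A /B.
  rewrite (_ : mono 1 (d * (2 * M).+1) = mono z (s + d * M) * mono z^-1 (t + d * M)); first by ring.
  by rewrite mono_mul divff //; congr (mono 1 _); rewrite /d; nia.
(* All sums are extended to [|k| <= M.+1], where [gauss M] vanishes at the new indices, so that [A]
   and [B] can be reindexed without boundary terms. *)
rewrite !ext; try by move=> k kM; rewrite /A /B /G gauss_out ?mul0r.
have -> : isum M.+1 A = isum M.+1 (fun k => A (k - 1)).
  have := isum_shift M.+1 A; rewrite /A !(gauss_out (k := _ : int)) ?mul0r ?addr0 //; lia.
have -> : isum M.+1 B = isum M.+1 (fun k => B (k + 1)).
  have B0 k : (M < `|k|)%N -> B k = 0 by move=> h; rewrite /B gauss_out ?mul0r.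
  have := isum_shift M.+1 (fun k => B (- k)).
  rewrite (isum_opp M.+1 B) !B0 ?addr0; [|lia..].
  move=> <-; rewrite -[RHS]isum_opp; apply: eq_isum => k _; congr B; lia.
rewrite -!isumD; apply: eq_isum => k kM; rewrite gauss_rec // /G /A /B !mulrDl.
congr (_ + _ + _); first by ring.
- case: (leqP `|k - 1| M) => h; last by rewrite gauss_out // !mul0r.
  by rewrite up // subrK -mulrA [term k * _]mulrC; congr (_ * (mono 1 (d * _) * _)); lia.
- case: (leqP `|k + 1| M) => h; last by rewrite gauss_out // !mul0r.
  by rewrite dn // addrK -mulrA [term k * _]mulrC; congr (_ * (mono 1 (d * _) * _)); lia.
Qed.

Lemma qpoch_eqm M : eqm M.+1 (qpoch M) (dil d (euler R)).
Proof. exact/eqm_dil/eulerp_eqm. Qed.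

(** For fixed [k], [gauss M k] tends to the inverse of [dil d euler]; the finite identity multiplied
    by that series therefore tends to [theta]. *)
Lemma triple_product :
  cvgs (fun M => dil d (euler R) *
    \prod_(i < M) ((1 + mono z (s + d * i)) * (1 + mono z^-1 (t + d * i)))) theta.
Proof.
pose P := dil d (euler R).
have uP : P \is a GRing.unit by apply: series_unit1; rewrite /P dil_coef0 euler0.
suff h M : eqm M (P * isum M (fun k => gauss M k * term k)) (isum M term).
  move=> N; have [M0 hM] := theta_cvg N; exists (maxn N M0) => M.
  rewrite geq_max => /andP[NM /hM]; apply: eqm_trans.
  by rewrite finite_triple_product; apply: eqm_le NM _.
rewrite /isum mulr_sumr; apply: eqm_sum => i _; set k := (_ - _)%R.
have kM : (`|k| <= M)%N by have := ltn_ord i; rewrite /k; lia.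
rewrite mulrA [_ * term k]mulrC -[X in eqm _ _ X]mulr1.
(* The binomial is known to precision [M - |k| + 1], and the term has order [texp k >= |k| - 1]:
   together at least [M]. *)
apply: (@eqm_le _ _ (texp k + (M - `|k|).+1)); first by have := texp_ge k; lia.
apply: eqmMo; first exact: mono_eqm0.
have -> : 1 = P * (P * P^-1 * P^-1) by rewrite divrr // mul1r divrr.
have hr j : (M - `|k| <= j)%N -> eqm (M - `|k|).+1 (rpoch j%:Z) P^-1.
  move=> hj; apply: eqmV => //; first exact: qpoch_unit.
  by apply: eqm_le _ (@qpoch_eqm j).
apply: eqmM => //; apply: eqmM.
  apply: eqmM; first by apply: eqm_le _ (@qpoch_eqm _); lia.
  have -> : M%:Z + k = (absz (M%:Z + k))%:Z by lia.
  by apply: hr; lia.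
have -> : M%:Z - k = (absz (M%:Z - k))%:Z by lia.
  by apply: hr; lia.
Qed.
End JacobiTripleProduct.

(** * Product formulas for theta series *)

Lemma prod_mul2 (R : comNzRingType) (g : nat -> R) M :
  \prod_(i < 2 * M) g i = \prod_(i < M) (g (2 * i)%N * g (2 * i).+1).
Proof.
elim: M => [|M IH]; first by rewrite muln0 !big_ord0.
by rewrite (_ : 2 * M.+1 = (2 * M).+2)%N ?mulnS // !big_ord_recr /= IH mulrA.
Qed.
Lemma prod_mul3 (R : comNzRingType) (g : nat -> R) M :
  \prod_(i < 3 * M) g i = \prod_(i < M) (g (3 * i)%N * g (3 * i).+1 * g (3 * i).+2).
Proof.
elim: M => [|M IH]; first by rewrite muln0 !big_ord0.
by rewrite (_ : 3 * M.+1 = (3 * M).+3)%N ?mulnS // !big_ord_recr /= IH !mulrA.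
Qed.

Section ThetaProducts.
Variable R : fieldType.
Implicit Types (M k : nat).

Definition eu k : series R := dil k (euler R).
Definition phi : series R := theta (1 : R) 1 1.
(** At [z = 1] this is [2 psi], since [k] and [- 1 - k] give the same triangular number. *)
Definition theta_tri (z : R) : series R := theta z 1 0.
(** [\sum_k q ^ (k (3 k + 1) / 2)]: the pentagonal exponents, without signs. *)
Definition theta_pent : series R := theta (1 : R) 2 1.

Lemma eu_cvg k : cvgs (fun M => dil k (eulerp R M)) (eu k).
Proof. exact: euler_dil_cvg. Qed.
Lemma eulerp_cvg1 : cvgs (eulerp R) (eu 1).
Proof. by rewrite /eu dil1; apply: euler_cvg. Qed.
Lemma eu0 k : eu k 0%N = 1. Proof. by rewrite /eu dil_coef0 euler0. Qed.
Lemma eu_neq0 k : eu k != 0.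
Proof.
by apply/eqP => /(congr1 (@^~ 0%N)) /eqP; rewrite eu0 oner_eq0.
Qed.
Lemma dil_eu j k : dil j.+1 (eu k.+1) = eu (j.+1 * k.+1).
Proof. exact: dil_dil. Qed.

Lemma leq_mul2 M : (M <= 2 * M)%N. Proof. lia. Qed.
Lemma leq_mul3 M : (M <= 3 * M)%N. Proof. lia. Qed.

(** The triple product gives [phi]; splitting the Euler products by the parity of the index leaves
    an identity between the factors of each index [i]. The other product formulas follow the same
    pattern. *)
Lemma phi_prod : phi * (eu 1 ^+ 2 * eu 4 ^+ 2) = eu 2 ^+ 5.
Proof.
have -> : eu 2 ^+ 5 = eu 2 * (eu 2 ^+ 2 * eu 2 ^+ 2) by ring.
apply: (@cvgs_uniq _ (fun M => (dil 2 (euler R) *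
    \prod_(i < M) ((1 + mono 1 (1 + 2 * i)) * (1 + mono 1^-1 (1 + 2 * i)))) *
    (eulerp R (2 * M) ^+ 2 * dil 4 (eulerp R M) ^+ 2))).
  apply: cvgsM; first exact: (@triple_product R 1 1 1 (oner_neq0 R) isT).
  apply: cvgsM; last exact/cvgsX/eu_cvg.
  exact/cvgsX/(cvgs_sub leq_mul2)/eulerp_cvg1.
have -> : (fun M => (dil 2 (euler R) *
    \prod_(i < M) ((1 + mono 1 (1 + 2 * i)) * (1 + mono 1^-1 (1 + 2 * i)))) *
    (eulerp R (2 * M) ^+ 2 * dil 4 (eulerp R M) ^+ 2)) =
  (fun M => eu 2 * (dil 2 (eulerp R (2 * M)) ^+ 2 * dil 2 (eulerp R M) ^+ 2)).
  apply/funext => M; rewrite -mulrA; congr (_ * _).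
  rewrite !dil_eulerp /eulerp (prod_mul2 (fun j => 1 - mono 1 j.+1))
    (prod_mul2 (fun j => 1 - mono 1 (2 * j.+1))) !(expr2, invr1) -!big_split /=.
  apply: eq_bigr => i _.
  set y := mono 1 (1 + 2 * i); set w := mono 1 (2 * i).+2.
  have -> : mono 1 (2 * (2 * i).+1) = y ^+ 2 :> series R by rewrite monoX; congr mono; lia.
  have -> : mono 1 (2 * (2 * i).+2) = w ^+ 2 :> series R by rewrite monoX; congr mono; lia.
  have -> : mono 1 (4 * i.+1) = w ^+ 2 :> series R by rewrite monoX; congr mono; lia.
  have -> : mono 1 (2 * i.+1) = w :> series R by congr mono; lia.
  ring.
apply: cvgsM; first exact: cvgs_cst.
apply: cvgsM; last exact/cvgsX/eu_cvg.
by apply/cvgsX/(cvgs_sub leq_mul2 (s := fun M => dil 2 (eulerp R M)))/eu_cvg.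
Qed.

Lemma theta_pent_prod : theta_pent * (eu 1 * eu 6) = eu 2 * eu 3 ^+ 2.
Proof.
have -> : eu 2 * eu 3 ^+ 2 = eu 3 * (eu 2 * eu 3) by ring.
apply: (@cvgs_uniq _ (fun M => (dil 3 (euler R) *
    \prod_(i < M) ((1 + mono 1 (2 + 3 * i)) * (1 + mono 1^-1 (1 + 3 * i)))) *
    (eulerp R (3 * M) * dil 6 (eulerp R M)))).
  apply: cvgsM; first exact: (@triple_product R 1 2 1 (oner_neq0 R) isT).
  apply: cvgsM; last exact/eu_cvg.
  exact/(cvgs_sub leq_mul3)/eulerp_cvg1.
have -> : (fun M => (dil 3 (euler R) *
    \prod_(i < M) ((1 + mono 1 (2 + 3 * i)) * (1 + mono 1^-1 (1 + 3 * i)))) *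
    (eulerp R (3 * M) * dil 6 (eulerp R M))) =
  (fun M => eu 3 * (dil 2 (eulerp R (3 * M)) * dil 3 (eulerp R M))).
  apply/funext => M; rewrite -mulrA; congr (_ * _).
  rewrite !dil_eulerp /eulerp (prod_mul3 (fun j => 1 - mono 1 j.+1))
    (prod_mul3 (fun j => 1 - mono 1 (2 * j.+1))) invr1 -!big_split /=.
  apply: eq_bigr => i _.
  set y := mono 1 (1 + 3 * i); set v := mono 1 (2 + 3 * i); set w := mono 1 (3 * i).+3.
  have -> : mono 1 (2 * (3 * i).+1) = y ^+ 2 :> series R by rewrite monoX; congr mono; lia.
  have -> : mono 1 (2 * (3 * i).+2) = v ^+ 2 :> series R by rewrite monoX; congr mono; lia.
  have -> : mono 1 (2 * (3 * i).+3) = w ^+ 2 :> series R by rewrite monoX; congr mono; lia.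
  have -> : mono 1 (6 * i.+1) = w ^+ 2 :> series R by rewrite monoX; congr mono; lia.
  have -> : mono 1 (3 * i.+1) = w :> series R by congr mono; lia.
  ring.
apply: cvgsM; first exact: cvgs_cst.
apply: cvgsM; last exact/eu_cvg.
by apply/(cvgs_sub leq_mul3 (s := fun M => dil 2 (eulerp R M)))/eu_cvg.
Qed.

Lemma theta_tri1_prod : theta_tri 1 * eu 1 = 2 * eu 2 ^+ 2.
Proof.
apply: (mulIf (eu_neq0 1)).
have -> : 2 * eu 2 ^+ 2 * eu 1 = eu 1 * (2 * (eu 2 * eu 2)) by ring.
rewrite -mulrA.
(* With [t = 0] the first factor of the second product is 2; its other [M] factors are paired with
   [eulerp R M], and the [M.+1] factors of the first product with [eulerp R M.+1]. *)
apply: (@cvgs_uniq _ (fun M => (dil 1 (euler R) *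
    \prod_(i < M.+1) ((1 + mono 1 (1 + 1 * i)) * (1 + mono 1^-1 (0 + 1 * i)))) *
    (eulerp R M.+1 * eulerp R M))).
  apply: cvgsM.
    exact: (cvgs_sub (@leqnSn) (@triple_product R 1 1 0 (oner_neq0 R) isT)).
  apply: cvgsM; last exact/eulerp_cvg1.
  exact: (cvgs_sub (@leqnSn) eulerp_cvg1).
have -> : (fun M => (dil 1 (euler R) *
    \prod_(i < M.+1) ((1 + mono 1 (1 + 1 * i)) * (1 + mono 1^-1 (0 + 1 * i)))) *
    (eulerp R M.+1 * eulerp R M)) =
  (fun M => eu 1 * (2 * (dil 2 (eulerp R M.+1) * dil 2 (eulerp R M)))).
  apply/funext => M; rewrite -mulrA; congr (_ * _).
  have fac m : (1 + mono 1 m) * (1 - mono 1 m) = 1 - mono 1 (2 * m) :> series R.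
    by rewrite [(2 * m)%N]mulnC -monoX; ring.
  have -> : \prod_(i < M.+1) ((1 + mono 1 (1 + 1 * i)) * (1 + mono 1^-1 (0 + 1 * i)))
      = \prod_(i < M.+1) (1 + mono 1 i.+1) * (2 * \prod_(i < M) (1 + mono 1 i.+1)) :> series R.
    rewrite big_split /=; congr (_ * _); first by apply: eq_bigr => i _; rewrite mul1n.
    rewrite big_ord_recl muln0 invr1 mono1; congr (_ * _).
    by apply: eq_bigr => i _; rewrite mul1n.
  rewrite !dil_eulerp.
  under [X in _ = 2 * (X * _)]eq_bigr => i _ do rewrite -fac.
  under [X in _ = 2 * (_ * X)]eq_bigr => i _ do rewrite -fac.
  by rewrite !big_split /= /eulerp; ring.
do 2?[apply: cvgsM; first exact: cvgs_cst].
by apply: cvgsM (eu_cvg 2); apply/(cvgs_sub (@leqnSn) (s := fun M => dil 2 (eulerp R M)))/eu_cvg.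
Qed.

(** The factors of the triple product pair up as [(1 + w y) (1 + w^2 y) = 1 - y + y^2 = (1 + y^3) /
    (1 + y)] with [y] a power of [q]. *)
Lemma theta_tri_prim_prod (w : R) : 1 + w + w ^+ 2 = 0 ->
  theta_tri w * (eu 2 * eu 3) = mono (1 + w ^+ 2) 0 * (eu 1 ^+ 2 * eu 6).
Proof.
move=> hw; have w_cubed : w * w ^+ 2 = 1.
  have e : w * w ^+ 2 - 1 = (w - 1) * (1 + w + w ^+ 2) by ring.
  by apply/eqP; rewrite -subr_eq0 e hw mulr0.
have w0 : w != 0 by apply: contraTneq (oner_neq0 R) => w0; rewrite -w_cubed w0 mul0r eqxx.
have wV : w^-1 = w ^+ 2 by apply: (mulfI w0); rewrite divff.
have -> : mono (1 + w ^+ 2) 0 * (eu 1 ^+ 2 * eu 6) = eu 1 * (mono (1 + w ^+ 2) 0 * (eu 1 * eu 6)).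
  by ring.
pose P M : series R := \prod_(i < M) ((1 + mono w (1 + 1 * i)) * (1 + mono w^-1 (0 + 1 * i))).
have hP : cvgs (fun M => dil 1 (euler R) * P M) (theta_tri w).
  exact: (@triple_product R w 1 0 w0 isT).
pose T M : series R := \prod_(i < M) (1 + mono w i.+1) * \prod_(i < M) (1 + mono w^-1 i.+1).
(* The second product of [P M] starts at exponent 0; an extra factor, which tends to 1, moves its
   range to the exponents 1 to [M]. *)
have PT M : P M * (1 + mono w^-1 M) = (1 + mono w^-1 0) * T M.
  rewrite /P big_split /=.
  have -> : \prod_(i < M) (1 + mono w (1 + 1 * i)) = \prod_(i < M) (1 + mono w i.+1) :> series R.
    by apply: eq_bigr => i _; rewrite mul1n add1n.
  rewrite -mulrA /T [in RHS]mulrCA; congr (_ * _).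
  have -> : \prod_(i < M) (1 + mono w^-1 (0 + 1 * i)) = \prod_(i < M) (1 + mono w^-1 i) :> series R.
    by apply: eq_bigr => i _; rewrite mul1n add0n.
  transitivity (\prod_(i < M.+1) (1 + mono w^-1 i) : series R).
    by rewrite big_ord_recr.
  by rewrite big_ord_recl.
apply: (@cvgs_uniq _ (fun M => dil 1 (euler R) * P M * (1 + mono w^-1 M) *
    (dil 2 (eulerp R M) * dil 3 (eulerp R M)))).
  rewrite -[theta_tri w]mulr1; apply: cvgsM; last exact: cvgsM (eu_cvg 2) (eu_cvg 3).
  apply: cvgsM => //; apply: cvgs_eqm => M; rewrite -[X in eqm _ _ X]addr0.
  by apply: eqmD => //; apply: mono_eqm0.
have -> : (fun M => dil 1 (euler R) * P M * (1 + mono w^-1 M) *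
    (dil 2 (eulerp R M) * dil 3 (eulerp R M))) =
  (fun M => eu 1 * (mono (1 + w ^+ 2) 0 * (eulerp R M * dil 6 (eulerp R M)))).
  apply/funext => M; rewrite -!mulrA; congr (_ * _); rewrite mulrA PT -mulrA; congr (_ * _).
    by rewrite -mono1 wV; apply/funext => n; rewrite coef_add /mono -mulrnDl.
  rewrite /T !dil_eulerp /eulerp -!big_split /=; apply: eq_bigr => i _; rewrite wV.
  set y := mono 1 i.+1.
  have -> : mono 1 (2 * i.+1) = y ^+ 2 :> series R by rewrite monoX; congr mono; lia.
  have -> : mono 1 (3 * i.+1) = y ^+ 3 :> series R by rewrite monoX; congr mono; lia.
  have -> : mono 1 (6 * i.+1) = y ^+ 6 :> series R by rewrite monoX; congr mono; lia.
  have monoc c : mono c i.+1 = mono c 0 * y by rewrite mono_mul mulr1 add0n.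
  rewrite !(monoc w) (monoc (w ^+ 2)).
  have s1 : mono w 0 * mono (w ^+ 2) 0 = 1 by rewrite mono_mul w_cubed mono1.
  have s2 : mono w 0 + mono (w ^+ 2) 0 = -1.
    rewrite -mono1; apply/funext => n; rewrite coef_add coef_opp /mono -mulrnDl -mulNrn.
    by congr (_ *+ _); rewrite -[LHS](addKr 1) [1 + (_ + _)]addrA hw addr0.
  have -> : (1 + mono w 0 * y) * (1 + mono (w ^+ 2) 0 * y) = 1 - y + y ^+ 2.
    transitivity (1 + (mono w 0 + mono (w ^+ 2) 0) * y + mono w 0 * mono (w ^+ 2) 0 * y ^+ 2).
      by ring.
    by rewrite s1 s2; ring.
  ring.
apply: cvgsM; first exact: cvgs_cst.
apply: cvgsM; first exact: cvgs_cst.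
exact: cvgsM eulerp_cvg1 (eu_cvg 6).
Qed.
End ThetaProducts.

(** * Dissections of theta series *)

Section ThetaDissections.
Variable R : fieldType.

Lemma term_dil k (z : R) s t j : dil k.+1 (term z s t j) = mono (z ^ j) (k.+1 * texp s t j).
Proof. exact: dil_mono. Qed.

(* Split the summation index [k] of [z ^ k * q ^ (k (k + 1) / 2)] modulo 3. *)
Lemma theta_tri_mod3 (z : R) : z ^+ 3 = 1 ->
  theta_tri z = mono (1 + z^-1) 0 * dil 3 (theta_pent R) + mono z 1 * dil 9 (theta_tri 1).
Proof.
move=> z3; have z0 : z != 0 by apply: contraTneq (oner_neq0 R) => z0; rewrite -z3 z0 expr0n eqxx.
have z3k (k : int) : z ^ (3 * k) = 1 by rewrite -exprz_exp -exprnP z3 exp1rz.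
pose p (k : int) := dil 3 (term (1 : R) 2 1 k); pose r (k : int) := dil 9 (term (1 : R) 1 0 k).
have subM M : (M <= (3 * M).+1)%N by lia.
apply: (@cvgs_uniq _ (fun M => isum (3 * M).+1 (term z 1 0))).
  exact: (cvgs_sub subM (@theta_cvg R z 1 0 isT)).
have -> : (fun M => isum (3 * M).+1 (term z 1 0)) =
    (fun M => mono (1 + z^-1) 0 * dil 3 (isum M (term 1 2 1)) + mono z 1 * dil 9 (isum M (term 1 1 0))).
  apply/funext => M; rewrite isum_mod3.
  (* The indices [3 k - 1] and [3 k] give 3 times a pentagonal exponent, at [- k] and [k]; the index
     [3 k + 1] gives [1 + 9 k (k + 1) / 2]. *)
  transitivity (isum M (fun k => mono z^-1 0 * p (- k) + p k + mono z 1 * r k)).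
    apply: eq_isum => k _; rewrite /p /r !term_dil !exp1rz /term !mono_mul !mulr1.
    have := texp2 1 0 (3 * k - 1); have := texp2 1 0 (3 * k); have := texp2 1 0 (3 * k + 1).
    have := texp2 2 1 (- k); have := texp2 2 1 k; have := texp2 1 0 k.
    move=> h1 h2 h3 h4 h5 h6; congr (_ + _ + _).
    - by rewrite exprzDr ?unitfE // z3k mul1r exprN1; congr (mono _ _); nia.
    - by rewrite z3k; congr (mono _ _); nia.
    - by rewrite exprzDr ?unitfE // z3k mul1r expr1z; congr (mono _ _); nia.
  rewrite !isumD; congr (_ + _); last by rewrite /isum rmorph_sum -mulr_sumr.
  have -> : isum M (fun k => mono z^-1 0 * p (- k)) = mono z^-1 0 * isum M p.
    by rewrite -(isum_opp M p) /isum mulr_sumr.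
  have -> : mono (1 + z^-1) 0 = 1 + mono z^-1 0.
    by rewrite -mono1; apply/funext => n; rewrite coef_add /mono -mulrnDl.
  by rewrite mulrDl mul1r addrC /isum rmorph_sum.
apply: cvgsD; apply: cvgsM; try exact: cvgs_cst.
  exact: (cvgs_map (@eqm_dil R 3) (@theta_cvg R 1 2 1 isT)).
exact: (cvgs_map (@eqm_dil R 9) (@theta_cvg R 1 1 0 isT)).
Qed.

(** * Lattice point counts and Legendre's identity *)

Lemma size_bij (T1 T2 : eqType) (A : seq T1) (B : seq T2) (f : T1 -> T2) (g : T2 -> T1) :
  uniq A -> uniq B ->
  (forall x, x \in A -> f x \in B /\ g (f x) = x) ->
  (forall y, y \in B -> g y \in A /\ f (g y) = y) -> size A = size B.
Proof.
move=> uA uB fA gB; rewrite -(size_map f); apply: perm_size; apply: uniq_perm => //.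
  by rewrite map_inj_in_uniq // => x y /fA[_ {2}<-] /fA[_ {2}<-] ->.
move=> y; apply/mapP/idP => [[x /fA[? _] ->] //|/gB[gA fg]].
by exists (g y).
Qed.

Definition zseq M : seq int := [seq i%:Z - M%:Z | i <- iota 0 (2 * M + 1)].
Definition zbox M : seq (int * int) := [seq (k, l) | k <- zseq M, l <- zseq M].

Lemma zseqP M k : (k \in zseq M) = (`|k| <= M)%N.
Proof.
apply/mapP/idP => [[i]|kM]; first by rewrite mem_iota => ? ->; lia.
by exists (absz (k + M%:Z)); rewrite ?mem_iota; lia.
Qed.
Lemma zseq_uniq M : uniq (zseq M).
Proof. by rewrite map_inj_uniq ?iota_uniq // => i j; lia. Qed.
Lemma zboxP M p : (p \in zbox M) = (`|p.1| <= M)%N && (`|p.2| <= M)%N.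
Proof. 
case: p => k l; rewrite -!zseqP; apply/allpairsP/andP => [[[a b] [/= ? ? [-> ->]]]|[? ?]] //.
by exists (k, l). Qed.
Lemma zbox_uniq M : uniq (zbox M).
Proof. by apply: allpairs_uniq; rewrite ?zseq_uniq // => -[a b] [c d]. Qed.
Lemma isum_zseq (V : zmodType) M (F : int -> V) : isum M F = \sum_(k <- zseq M) F k.
Proof. by rewrite /zseq big_map -[X in iota 0 X]subn0 -/(index_iota 0 _) big_mkord. Qed.

Lemma lattice_coef M (e1 e2 : int -> nat) n :
  (isum M (fun k => mono (1 : R) (e1 k)) * isum M (fun k => mono 1 (e2 k))) n =
  (size [seq p <- zbox M | e1 p.1 + e2 p.2 == n]%N)%:R.
Proof.
transitivity ((\sum_(p <- zbox M) mono (1 : R) (e1 p.1) * mono 1 (e2 p.2)) n).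
  by rewrite !isum_zseq big_distrlr /= big_allpairs.
rewrite coef_sum size_filter -sum1_count natr_sum [RHS]big_mkcond; apply: eq_bigr => p _.
by rewrite mono_mul mulr1 /mono eq_sym; case: eqP.
Qed.

Lemma texp_phi k : (texp 1 1 k)%:Z = k * k.
Proof. have := texp2 1 1 k; nia. Qed.
Lemma texp_tri k : (texp 1 0 k)%:Z * 2 = k * (k + 1).
Proof. have := texp2 1 0 k; nia. Qed.

(** Modulo 2 the form [s^2 + 3 t^2] is [s + t]. *)
Lemma odd_form_parity (s t : int) (m : nat) : s * s + 3 * (t * t) = 2 * m%:Z + 1 ->
  exists u, s = 2 * u + 1 - t.
Proof.
move=> e; exists ((s + t) %/ 2)%Z.
have [h|h] : s = 2 * ((s + t) %/ 2)%Z - t \/ s = 2 * ((s + t) %/ 2)%Z + 1 - t by lia.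
  by exfalso; move: h e; move: ((s + t) %/ 2)%Z => u ->; nia.
exact: h.
Qed.

(* The pairs [(k, l)] with [k - l] even, resp. odd, correspond to the pairs [(s, t)] through
   [2 k + 1 = s + 3 t] and [2 l + 1 = s - t], resp. [2 l + 1 = t - s]. *)
Lemma legendre_count M m : (2 * m < M)%N ->
  size [seq p <- zbox M | 2 * texp 1 0 p.1 + 6 * texp 1 0 p.2 == 2 * m]%N =
  (2 * size [seq p <- zbox M | texp 1 1 p.1 + 3 * texp 1 1 p.2 == (2 * m).+1]%N)%N.
Proof.
move=> mM; set A := [seq p <- _ | _ == (2 * m).+1]; set B := [seq p <- _ | _].
(* Since [2 * m < M], every integral solution lies in the box, so membership in [A] and in [B] is
   just the quadratic equation. *)
have AP p : (p \in A) = (p.1 * p.1 + 3 * (p.2 * p.2) == 2 * m%:Z + 1).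
  case: p => s t; rewrite mem_filter zboxP /=.
  have := texp_phi s; have := texp_phi t; move=> ht hs.
  apply/andP/eqP => [[/eqP h _]|h]; first by rewrite -hs -ht; lia.
  by split; [lia | apply/andP; split; nia].
have BP p : (p \in B) = (p.1 * (p.1 + 1) + 3 * (p.2 * (p.2 + 1)) == 2 * m%:Z).
  case: p => k l; rewrite mem_filter zboxP /=.
  have := texp_tri k; have := texp_tri l; move=> hl hk.
  apply/andP/eqP => [[/eqP h _]|h]; first by rewrite -hl -hk; lia.
  by split; [lia | apply/andP; split; nia].
have uA : uniq A by rewrite filter_uniq ?zbox_uniq.
have uB : uniq B by rewrite filter_uniq ?zbox_uniq.
(* [P] says that [k - l] is even. Each half of [B] is in bijection with [A], by [(s + 3 t)^2 + 3 (s
   - t)^2 = 4 (s^2 + 3 t^2)]. *)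
pose P (p : int * int) := p.1 - p.2 == 2 * ((p.1 - p.2) %/ 2)%Z.
rewrite -(count_predC P B) mul2n -addnn -!size_filter.
pose u (p : int * int) := ((p.1 + p.2 - 1) %/ 2)%Z.
have half x : ((2 * x) %/ 2)%Z = x by rewrite mulKz.
congr addn; symmetry.
  apply: (@size_bij _ _ _ _ (fun p => (u p + p.2, u p - p.2))
    (fun p => (p.1 + p.2 + 1 - ((p.1 - p.2) %/ 2)%Z, ((p.1 - p.2) %/ 2)%Z)));
    rewrite ?filter_uniq ?zbox_uniq //.
    case=> s t; rewrite AP /= => /eqP h; have [v e] := odd_form_parity h.
    have -> : u (s, t) = v by rewrite /u /= -[RHS]half; congr divz; lia.
    rewrite mem_filter BP /P /= (_ : v + t - (v - t) = 2 * t) ?half; last by lia.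
    split; first by rewrite eqxx; apply/eqP; move: h; rewrite e; nia.
    by congr pair; lia.
  case=> k l; rewrite mem_filter BP /P /= => /andP[/eqP]; move: ((k - l) %/ 2)%Z => t e /eqP h.
  rewrite AP /=; have -> : u (k + l + 1 - t, t) = l + t.
    by rewrite /u /= -[RHS]half; congr divz; lia.
  have ek : k = l + 2 * t by lia.
  by split; [apply/eqP; rewrite ek; move: h; rewrite ek; nia | congr pair; lia].
apply: (@size_bij _ _ _ _ (fun p => (u p + p.2, p.2 - u p - 1))
    (fun p => (p.1 - p.2 - ((p.1 + p.2 + 1) %/ 2)%Z, ((p.1 + p.2 + 1) %/ 2)%Z)));
    rewrite ?filter_uniq ?zbox_uniq //.
  case=> s t; rewrite AP /= => /eqP h; have [v e] := odd_form_parity h.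
  have -> : u (s, t) = v by rewrite /u /= -[RHS]half; congr divz; lia.
  rewrite mem_filter BP /P /= (_ : v + t + (t - v - 1) + 1 = 2 * t) ?half; last by lia.
  split; first by apply/andP; split; [lia | apply/eqP; move: h; rewrite e; nia].
  by congr pair; lia.
case=> k l; rewrite mem_filter BP /P /= => /andP[kl /eqP h].
have [t e] : exists t, k = 2 * t - l - 1 by exists ((k + l + 1) %/ 2)%Z; lia.
have -> : ((k + l + 1) %/ 2)%Z = t by rewrite -[RHS]half; congr divz; lia.
rewrite AP /=; have -> : u (k - l - t, t) = t - l - 1.
  by rewrite /u /= -[RHS]half; congr divz; lia.
by split; [apply/eqP; move: h; rewrite e; nia | congr pair; lia].
Qed.

(** Twice the odd part of [phi(q) phi(q^3)]. Coefficients are read off partial sums, where they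
    count lattice points, and compared by [legendre_count]. *)
Lemma legendre : phi R * dil 3 (phi R) - twist (-1) (phi R * dil 3 (phi R)) =
  mono 1 1 * (dil 2 (theta_tri 1) * dil 6 (theta_tri 1)).
Proof.
apply/funext => n; rewrite coef_add coef_opp /twist.
have [M nM] : exists M, (n < M)%N by exists n.+1.
have hphi : eqm M (isum M (fun k => mono 1 (texp 1 1 k)) * isum M (fun k => mono 1 (3 * texp 1 1 k)%N))
    (phi R * dil 3 (phi R)).
  have h := @theta_eqm R 1 1 1 isT M; apply: eqmM.
    by apply: eqm_trans h; rewrite (@eq_isum _ M _ (term 1 1 1)) // => k _; rewrite /term exp1rz.
  apply: eqm_trans (eqm_dil 3 h); rewrite /isum rmorph_sum; apply: eqm_sum => i _.
  by rewrite /= term_dil exp1rz.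
have htri : eqm M (isum M (fun k => mono 1 (2 * texp 1 0 k)%N) * isum M (fun k => mono 1 (6 * texp 1 0 k)%N))
    (dil 2 (theta_tri (1 : R)) * dil 6 (theta_tri 1)).
  have h := @theta_eqm R 1 1 0 isT M; apply: eqmM.
    apply: eqm_trans (eqm_dil 2 h); rewrite /isum rmorph_sum; apply: eqm_sum => i _.
    by rewrite /= term_dil exp1rz.
  apply: eqm_trans (eqm_dil 6 h); rewrite /isum rmorph_sum; apply: eqm_sum => i _.
  by rewrite /= term_dil exp1rz.
rewrite -hphi // (lattice_coef M (texp 1 1) (fun k => 3 * texp 1 1 k)%N) -signr_odd.
case: n nM => [|n] nM; first by rewrite mono_coef_lt // mul1r subrr.
rewrite mono_coef // subn1 mul1r -htri //; last exact: ltnW.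
rewrite (lattice_coef M (fun k => 2 * texp 1 0 k)%N (fun k => 6 * texp 1 0 k)%N) oddS succnK.
(* The coefficient is that of index [n.+1]: for [n] odd the left side cancels, and no even exponent
   on the right equals [n]. *)
have [on|en] := boolP (odd n); last first.
  rewrite expr1 mulN1r opprK -natrD; congr (_%:R).
  have [m e] : exists m, n = (2 * m)%N by exists n./2; lia.
  by subst n; rewrite (legendre_count (m := m)) ?[(2 * size _)%N]mul2n ?addnn //; exact: ltnW.
rewrite mul1r subrr (_ : filter _ _ = [::]) //; apply/eqP; rewrite -(negbK (_ == _)) -has_filter.
by apply/hasPn => p _; lia.
Qed.
End ThetaDissections.

(** * The two cubic identities *)

Lemma two_series_neq0 (R : fieldType) : (2 : R) != 0 -> (2 : series R) != 0.
Proof.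
apply: contra_neq => /(congr1 (@^~ 0%N)).
by rewrite -[2]/(1 + 1) coef_add coef_one.
Qed.

Section CubicNorm.
Variables (R : fieldType) (w : R).
Hypothesis hw : 1 + w + w ^+ 2 = 0.
Implicit Types f g : series R.

(** The norm down to series in [q ^ 3], [w] being a cube root of unity. *)
Definition cnorm f : series R := f * twist w f * twist (w ^+ 2) f.

Lemma w_cubed : w ^+ 3 = 1.
Proof.
have e : w ^+ 3 - 1 = (w - 1) * (1 + w + w ^+ 2) by ring.
by apply/eqP; rewrite -subr_eq0 e hw mulr0.
Qed.
Lemma w_neq0 : w != 0.
Proof. by apply: contraTneq (oner_neq0 R) => h; rewrite -w_cubed h expr0n eqxx. Qed.

Lemma cnorm1 : cnorm 1 = 1. Proof. by rewrite /cnorm !rmorph1 !mulr1. Qed.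
Lemma cnormM f g : cnorm (f * g) = cnorm f * cnorm g.
Proof. by rewrite /cnorm !rmorphM /=; ring. Qed.
Lemma cnormX f k : cnorm (f ^+ k) = cnorm f ^+ k.
Proof. by elim: k => [|k IH]; rewrite ?cnorm1 // !exprS cnormM IH. Qed.
Lemma cnorm_prod (F : nat -> series R) M : cnorm (\prod_(i < M) F i) = \prod_(i < M) cnorm (F i).
Proof. by elim: M => [|M IH]; rewrite ?big_ord0 ?cnorm1 // !big_ord_recr cnormM IH. Qed.
Lemma twist_dil3 k f : twist (w ^+ k) (dil 3 f) = dil 3 f.
Proof. by rewrite twist_dil exprAC w_cubed expr1n twist1. Qed.
Lemma cnorm_dil3 f : cnorm (dil 3 f) = dil 3 f ^+ 3.
Proof. by rewrite /cnorm -{1}(expr1 w) !twist_dil3 !exprS expr0 mulr1 mulrA. Qed.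
Lemma cnorm_dil2 f : cnorm (dil 2 f) = dil 2 (cnorm f).
Proof.
rewrite /cnorm !twist_dil -exprM (_ : w ^+ (2 * 2) = w); last first.
  by rewrite -[(2 * 2)%N]/3.+1 exprS w_cubed mulr1.
by rewrite !rmorphM /=; ring.
Qed.

Lemma mono0D (a b : R) : mono (a + b) 0 = mono a 0 + mono b 0.
Proof. by apply/funext => n; rewrite coef_add /mono -mulrnDl. Qed.
Lemma cnorm_root (c d y : series R) : c * d = 1 -> c + d = -1 ->
  (1 - y) * (1 - c * y) * (1 - d * y) = 1 - y ^+ 3.
Proof.
move=> h1 h2; transitivity ((1 - y) * (1 - (c + d) * y + c * d * y ^+ 2)); first by ring.
by rewrite h1 h2; ring.
Qed.
Lemma mono_w : mono w 0 * mono (w ^+ 2) 0 = 1 /\ mono w 0 + mono (w ^+ 2) 0 = -1.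
Proof.
split; first by rewrite mono_mul addn0 -exprS w_cubed mono1.
have : mono (1 + w + w ^+ 2) 0 = 0 :> series R by rewrite hw; apply/funext => n; rewrite /mono mul0rn.
by rewrite !mono0D mono1 -addrA => /eqP; rewrite addrC addr_eq0 => /eqP.
Qed.

Lemma cnorm_factor m : cnorm (1 - mono 1 m) =
  (1 - mono 1 m) * (1 - mono (w ^+ m) 0 * mono 1 m) * (1 - mono (w ^+ 2 ^+ m) 0 * mono 1 m).
Proof. by rewrite /cnorm !rmorphB !rmorph1 /= !twist_mono !mono_mul. Qed.

(** The norm of [1 - q ^ m] is [1 - q ^ (3 m)] when 3 does not divide [m], and [(1 - q ^ m) ^ 3]
    when it does. *)
Lemma cnorm_eu1 : cnorm (eu R 1) * eu R 9 = eu R 3 ^+ 4.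
Proof.
have -> : eu R 3 ^+ 4 = eu R 3 * eu R 3 ^+ 3 by ring.
have cN N f g : eqm N f g -> eqm N (cnorm f) (cnorm g).
  by move=> fg; apply: eqmM; [apply: eqmM|]; rewrite ?fg //; apply: eqm_twist.
apply: (@cvgs_uniq _ (fun M => cnorm (eulerp R (3 * M)) * dil 9 (eulerp R M))).
  apply: cvgsM (eu_cvg R 9).
  exact: (cvgs_map cN (cvgs_sub leq_mul3 (eulerp_cvg1 R))).
have -> : (fun M => cnorm (eulerp R (3 * M)) * dil 9 (eulerp R M)) =
  (fun M => dil 3 (eulerp R (3 * M)) * dil 3 (eulerp R M) ^+ 3).
  apply/funext => M; rewrite !dil_eulerp /eulerp (cnorm_prod (fun i => 1 - mono 1 i.+1)).
  rewrite (prod_mul3 (fun i => cnorm (1 - mono 1 i.+1))) (prod_mul3 (fun i => 1 - mono 1 (3 * i.+1))).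
  rewrite -prodrXl -!big_split /=; apply: eq_bigr => i _; rewrite !cnorm_factor.
  have wi j : w ^+ (3 * i + j) = w ^+ j by rewrite exprD exprM w_cubed expr1n mul1r.
  rewrite -(addn3 (3 * i)) -(addn2 (3 * i)) -(addn1 (3 * i)) ![w ^+ 2 ^+ _]exprAC !wi.
  rewrite w_cubed expr1n expr1 (_ : w ^+ 2 ^+ 2 = w); last first.
    by rewrite -exprM -[(2 * 2)%N]/3.+1 exprS w_cubed mulr1.
  have [h1 h2] := mono_w; have h1' := h1; have h2' := h2.
  rewrite mulrC in h1'; rewrite addrC in h2'; rewrite (cnorm_root _ h1 h2) (cnorm_root _ h1' h2') mono1.
  set y1 := mono 1 (3 * i + 1); set y2 := mono 1 (3 * i + 2); set y3 := mono 1 (3 * i + 3).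
  have -> : mono 1 (9 * i.+1) = y3 ^+ 3 :> series R by rewrite monoX; congr mono; lia.
  have -> : mono 1 (3 * (3 * i + 1)) = y1 ^+ 3 :> series R by rewrite monoX; congr mono; lia.
  have -> : mono 1 (3 * (3 * i + 2)) = y2 ^+ 3 :> series R by rewrite monoX; congr mono; lia.
  have -> : mono 1 (3 * (3 * i + 3)) = y3 ^+ 3 :> series R by rewrite monoX; congr mono; lia.
  have -> : mono 1 (3 * i.+1) = y3 :> series R by congr mono; lia.
  by ring.
apply: cvgsM; last exact/cvgsX/eu_cvg.
by apply/(cvgs_sub leq_mul3 (s := fun M => dil 3 (eulerp R M)))/eu_cvg.
Qed.

Lemma cnorm_eu2 : cnorm (eu R 2) * eu R 18 = eu R 6 ^+ 4.
Proof.
have := congr1 (dil 2) cnorm_eu1.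
by rewrite rmorphM rmorphXn /= !dil_eu -cnorm_dil2 dil_eu.
Qed.

Let u := dil 3 (theta_pent R).
Let v := dil 9 (theta_tri (1 : R)).
Let q : series R := mono 1 1.

Lemma u_prod : u * (eu R 3 * eu R 18) = eu R 6 * eu R 9 ^+ 2.
Proof. by have := congr1 (dil 3) (theta_pent_prod R); rewrite !(rmorphXn, rmorphM) /= !dil_eu. Qed.
Lemma v_prod : v * eu R 9 = 2 * eu R 18 ^+ 2.
Proof.
by have := congr1 (dil 9) (theta_tri1_prod R); rewrite !(rmorphXn, rmorphM) rmorph_nat /= !dil_eu.
Qed.

(** The hypotheses hold for series in [q ^ 3]; the mixed terms vanish because
    [1 + w + w ^ 2 = 0]. *)
Lemma cnorm_linear (a b : series R) : (forall k, twist (w ^+ k) a = a) ->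
  (forall k, twist (w ^+ k) b = b) -> cnorm (a + q * b) = a ^+ 3 + q ^+ 3 * b ^+ 3.
Proof.
move=> ha hb; have [h1 h2] := mono_w; have w1 := expr1 w.
have tq k : twist (w ^+ k) q = mono (w ^+ k) 0 * q.
  by rewrite /q twist_mono expr1 mono_mul.
rewrite /cnorm -{1}w1 !rmorphD !rmorphM /= !ha !hb !tq w1.
transitivity (a ^+ 3 + (1 + (mono w 0 + mono (w ^+ 2) 0)) * a ^+ 2 * q * b +
  (mono w 0 * mono (w ^+ 2) 0 + (mono w 0 + mono (w ^+ 2) 0)) * a * q ^+ 2 * b ^+ 2
  + mono w 0 * mono (w ^+ 2) 0 * q ^+ 3 * b ^+ 3); first by ring.
by rewrite h1 h2; ring.
Qed.

Lemma twist_v k : twist (w ^+ k) v = v.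
Proof. by rewrite /v -(dil_dil 2 2) twist_dil3. Qed.

(** The formula for [X + Y], multiplied by [f_1^4 f_3^3 f_6^3]. It is the norm of
    [theta_tri 1 = 2 u + q v], an identity in [q ^ 3], read in [q]; cancelling 8 uses [2 != 0]. *)
Lemma cubic_sum : (2 : R) != 0 -> eu R 1 * eu R 2 ^+ 3 * eu R 3 ^+ 9 + q * eu R 1 ^+ 4 * eu R 6 ^+ 9
  = eu R 2 ^+ 8 * eu R 3 ^+ 4 * eu R 6.
Proof.
move=> two_neq0; apply: (@dil_inj _ 3).
rewrite rmorphD !(rmorphXn, rmorphM) /= !dil_eu dil_mono -[(3 * 1)%N]/3%N.
have -> : mono 1 3 = q ^+ 3 by rewrite monoX.
have hA : cnorm (theta_tri (1 : R)) * cnorm (eu R 1) = 8 * cnorm (eu R 2) ^+ 2.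
  rewrite -cnormM theta_tri1_prod cnormM cnormX; congr (_ * _).
  by rewrite /cnorm !rmorph_nat; ring.
have e : cnorm (theta_tri (1 : R)) = 8 * u ^+ 3 + q ^+ 3 * v ^+ 3.
  rewrite (theta_tri_mod3 (expr1n _ _)) invr1 -/u -/v mono0D mono1.
  rewrite (_ : (1 + 1) * u = 2 * u) // cnorm_linear; [by ring| |exact: twist_v].
  by move=> k; rewrite /u rmorphM rmorph_nat /= twist_dil3.
have nz : 8 * eu R 3 ^+ 3 * eu R 18 ^+ 2 != 0.
  rewrite !mulf_neq0 ?expf_neq0 ?eu_neq0 // (_ : 8 = 2 ^+ 3); last by ring.
  by rewrite expf_neq0 ?two_series_neq0.
have [hu hv n1 n2] := And4 u_prod v_prod cnorm_eu1 cnorm_eu2.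
apply: (mulfI nz); rewrite e in hA.
(* The last factor collects the denominators of [cnorm (eu R 1)], [cnorm (eu R 2) ^+ 2], [u ^+ 3]
   and [v ^+ 3]. *)
transitivity ((8 * u ^+ 3 + q ^+ 3 * v ^+ 3) * cnorm (eu R 1) *
    (eu R 9 * eu R 18 ^+ 2 * (eu R 3 * eu R 18 * eu R 9) ^+ 3)).
  transitivity ((8 * (u * (eu R 3 * eu R 18)) ^+ 3 * eu R 9 ^+ 3
    + q ^+ 3 * (v * eu R 9) ^+ 3 * (eu R 3 * eu R 18) ^+ 3) * (cnorm (eu R 1) * eu R 9) * eu R 18 ^+ 2).
    by rewrite hu hv n1; ring.
  by ring.
rewrite hA.
transitivity (8 * (cnorm (eu R 2) * eu R 18) ^+ 2 * eu R 3 ^+ 3 * eu R 18 ^+ 3 * eu R 9 ^+ 4).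
  by ring.
by rewrite n2; ring.
Qed.

(** The formula for [X - 8 Y], multiplied by [f_1^3 f_2 f_3^3 f_6^3], from the norm of [u - q v]. *)
Lemma cubic_diff : eu R 2 ^+ 4 * eu R 3 ^+ 9 - 8 * q * eu R 1 ^+ 3 * eu R 2 * eu R 6 ^+ 9
  = eu R 1 ^+ 8 * eu R 3 * eu R 6 ^+ 4.
Proof.
apply: (@dil_inj _ 3); rewrite rmorphB !(rmorphXn, rmorphM) rmorph_nat /= !dil_eu dil_mono -[(3 * 1)%N]/3%N.
have -> : mono 1 3 = q ^+ 3 by rewrite monoX.
have wV : w^-1 = w ^+ 2 by apply: (mulfI w_neq0); rewrite divff ?w_neq0 // -exprS w_cubed.
(* As [1 + w^-1 = - w], the dissection reads [theta_tri w = - w (u - q v)], and [- w] cancels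
   against the constant in the product formula. *)
have hB : (u - q * v) * (eu R 2 * eu R 3) = eu R 1 ^+ 2 * eu R 6.
  have w12 : 1 + w ^+ 2 = - w by apply/eqP; rewrite -addr_eq0 addrAC hw.
  have mN : mono (- w) 0 = - mono w 0.
    by apply/funext => n; rewrite coef_opp /mono mulNrn.
  have := theta_tri_prim_prod hw; rewrite (theta_tri_mod3 w_cubed) wV w12 -/u -/v mN => h.
  have nz : mono w 0 != 0 :> series R.
    by apply: contra_neq w_neq0 => /(congr1 (@^~ 0%N)).
  have mw : mono w 1 = mono w 0 * q by rewrite mono_mul mulr1.
  apply: (mulfI nz); apply: oppr_inj; rewrite -[RHS]mulNr -h mw; ring.
have e : cnorm (u - q * v) = u ^+ 3 - q ^+ 3 * v ^+ 3.
  rewrite -mulrN cnorm_linear; first by ring.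
    by move=> k; rewrite /u twist_dil3.
  by move=> k; rewrite rmorphN /= twist_v.
have hA : (u ^+ 3 - q ^+ 3 * v ^+ 3) * cnorm (eu R 2) * eu R 3 ^+ 3 = cnorm (eu R 1) ^+ 2 * eu R 6 ^+ 3.
  have := congr1 cnorm hB; rewrite !(cnormX, cnormM) e.
  by rewrite -{1}[eu R 3](dil_eu R 2 0) -[eu R 6](dil_eu R 2 1) !cnorm_dil3 !dil_eu mulrA.
have nz : eu R 6 ^+ 3 * eu R 3 ^+ 3 * eu R 9 ^+ 2 != 0.
  by rewrite !mulf_neq0 ?expf_neq0 ?eu_neq0.
have [hu hv n1 n2] := And4 u_prod v_prod cnorm_eu1 cnorm_eu2.
apply: (mulfI nz).
transitivity ((u ^+ 3 - q ^+ 3 * v ^+ 3) * cnorm (eu R 2) * eu R 3 ^+ 3 *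
    (eu R 18 * eu R 9 ^+ 2 * (eu R 3 * eu R 18 * eu R 9) ^+ 3)).
  transitivity (((u * (eu R 3 * eu R 18)) ^+ 3 * eu R 9 ^+ 3
    - q ^+ 3 * (v * eu R 9) ^+ 3 * (eu R 3 * eu R 18) ^+ 3) * (cnorm (eu R 2) * eu R 18) *
    eu R 3 ^+ 3 * eu R 9 ^+ 2).
    by rewrite hu hv n2; ring.
  by ring.
rewrite hA.
transitivity ((cnorm (eu R 1) * eu R 9) ^+ 2 * eu R 6 ^+ 3 * eu R 3 ^+ 3 * eu R 18 ^+ 4 * eu R 9 ^+ 3).
  by ring.
by rewrite n1; ring.
Qed.
End CubicNorm.

(** * Descent of the cubic identities along a field extension *)

Section MapSeries.
Variables (R S : fieldType) (h : {rmorphism R -> S}).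

Definition map_series (f : series R) : series S := fun n => h (f n).
Fact map_series_additive : zmod_morphism map_series.
Proof. by move=> f g; apply/funext => n; apply: rmorphB. Qed.
Fact map_series_multiplicative : monoid_morphism map_series.
Proof.
split=> [|f g]; apply/funext => n; rewrite /map_series.
  by rewrite !coef_one rmorph_nat.
by rewrite !coef_mul rmorph_sum; apply: eq_bigr => i _; rewrite rmorphM.
Qed.
HB.instance Definition _ := GRing.isZmodMorphism.Build _ _ map_series map_series_additive.
HB.instance Definition _ := GRing.isMonoidMorphism.Build _ _ map_series map_series_multiplicative.

Lemma map_series_inj : injective map_series.
Proof. by move=> f g e; apply/funext => n; apply/(fmorph_inj h)/(congr1 (@^~ n) e). Qed.
Lemma map_mono c m : map_series (mono c m) = mono (h c) m.
Proof. by apply/funext => n; rewrite /map_series /mono rmorphMn. Qed.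
Lemma map_eu k : map_series (eu R k) = eu S k.
Proof.
apply/funext => n; rewrite /map_series /eu /dil; case: ifP => _; last exact: rmorph0.
have mapE m : map_poly h (\prod_(i < m) (1 - 'X^(i.+1))) = \prod_(i < m) (1 - 'X^(i.+1)).
  by rewrite rmorph_prod; apply: eq_bigr => i _; rewrite rmorphB rmorph1 /= map_polyXn.
by rewrite /euler -mapE coef_map.
Qed.

(** The identity only involves integers, and [map_series] is injective, so the cube root of unity
    may live in the extension [S]. *)
Lemma cubic_sum_descent (w : S) : 1 + w + w ^+ 2 = 0 -> (2 : S) != 0 ->
  eu R 1 * eu R 2 ^+ 3 * eu R 3 ^+ 9 + mono 1 1 * eu R 1 ^+ 4 * eu R 6 ^+ 9
  = eu R 2 ^+ 8 * eu R 3 ^+ 4 * eu R 6.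
Proof.
move=> hw two0; apply: map_series_inj.
rewrite rmorphD !(rmorphXn, rmorphM) /= !map_eu map_mono rmorph1.
exact: cubic_sum hw two0.
Qed.
Lemma cubic_diff_descent (w : S) : 1 + w + w ^+ 2 = 0 ->
  eu R 2 ^+ 4 * eu R 3 ^+ 9 - 8 * mono 1 1 * eu R 1 ^+ 3 * eu R 2 * eu R 6 ^+ 9
  = eu R 1 ^+ 8 * eu R 3 * eu R 6 ^+ 4.
Proof.
move=> hw; apply: map_series_inj.
rewrite rmorphB !(rmorphXn, rmorphM) rmorph_nat /= !map_eu map_mono rmorph1.
exact: cubic_diff hw.
Qed.
End MapSeries.

Lemma cube_root_unity : exists w : algC, 1 + w + w ^+ 2 = 0.
Proof.
pose s : algC := sqrtC (- 3); exists ((s - 1) / 2).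
have hs : s ^+ 2 = - 3 by rewrite sqrtCK.
transitivity ((s ^+ 2 + 3) / 4); first by field.
by rewrite hs addNr mul0r.
Qed.

(** * The even part of phi(q) phi(q^3) *)

Section EvenPart.
Variable R : fieldType.
Hypothesis two_neq0 : (2 : R) != 0.
Implicit Types f g : series R.
Local Notation e := (eu R).
Local Notation tw := (twist (-1 : R)).
Let q : series R := mono 1 1.

Definition even_part f : series R := fun n => f (2 * n)%N.

Lemma even_part_eq f : f + tw f = 2 * dil 2 (even_part f).
Proof.
apply/funext => n; rewrite coef_add /twist -signr_odd mulrDl mul1r coef_add /dil /=.
rewrite dvdn2 /even_part; case: ifPn => [en|]; last by rewrite negbK => ->; rewrite mulN1r subrr addr0.
by rewrite (negbTE en) mul1r muln_divA ?dvdn2 // mulKn.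
Qed.
(** A series in [q ^ 2] is fixed by [q |-> - q], hence factors out of [g(q) + g(- q)]. *)
Lemma even_partM f g : even_part (dil 2 f * g) = f * even_part g.
Proof.
apply: (@dil_inj _ 2); apply: (mulfI (two_series_neq0 two_neq0)).
rewrite -even_part_eq !rmorphM /= [RHS]mulrCA -even_part_eq twist_dil sqrrN expr1n twist1.
by rewrite mulrDr.
Qed.

Lemma twist_euler : tw (e 1) * (e 1 * e 4) = e 2 ^+ 3.
Proof.
have -> : e 2 ^+ 3 = e 2 * e 2 ^+ 2 by ring.
apply: (@cvgs_uniq _ (fun M => tw (eulerp R (2 * M)) * (eulerp R (2 * M) * dil 4 (eulerp R M)))).
  have h := cvgs_sub leq_mul2 (eulerp_cvg1 R).
  apply: cvgsM; first exact: (cvgs_map (@eqm_twist R (-1)) h).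
  by apply: cvgsM (eu_cvg R 4).
have -> : (fun M => tw (eulerp R (2 * M)) * (eulerp R (2 * M) * dil 4 (eulerp R M))) =
  (fun M => dil 2 (eulerp R (2 * M)) * dil 2 (eulerp R M) ^+ 2).
  apply/funext => M; rewrite {1}/eulerp rmorph_prod.
  rewrite (eq_bigr (fun i : 'I__ => 1 - mono ((-1) ^+ i.+1) i.+1)); last first.
    by move=> i _; rewrite rmorphB rmorph1 /= twist_mono mulr1.
  rewrite !dil_eulerp /eulerp (prod_mul2 (fun j => 1 - mono 1 j.+1)).
  rewrite (prod_mul2 (fun j => 1 - mono 1 (2 * j.+1))) (prod_mul2 (fun j => 1 - mono ((-1) ^+ j.+1) j.+1)).
  rewrite expr2 -!big_split /=; apply: eq_bigr => i _.
  have -> : (-1) ^+ (2 * i).+1 = -1 :> R by rewrite exprS exprM sqrrN !expr1n mulr1.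
  have -> : (-1) ^+ (2 * i).+2 = 1 :> R by rewrite !exprS exprM sqrrN !expr1n mulr1 mulrNN mulr1.
  set y := mono 1 (2 * i).+1; set w := mono 1 (2 * i).+2.
  have -> : mono (-1) (2 * i).+1 = - y :> series R.
    by apply/funext => n; rewrite coef_opp /y /mono mulNrn.
  have -> : mono 1 (2 * (2 * i).+1) = y ^+ 2 :> series R by rewrite monoX; congr mono; lia.
  have -> : mono 1 (2 * (2 * i).+2) = w ^+ 2 :> series R by rewrite monoX; congr mono; lia.
  have -> : mono 1 (4 * i.+1) = w ^+ 2 :> series R by rewrite monoX; congr mono; lia.
  have -> : mono 1 (2 * i.+1) = w :> series R by congr mono; lia.
  ring.
apply: cvgsM; last exact/cvgsX/eu_cvg.
by apply/(cvgs_sub leq_mul2 (s := fun M => dil 2 (eulerp R M)))/eu_cvg.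
Qed.

(** In the product of [phi_prod] with its image under [q |-> - q], the square of [twist_euler]
    eliminates [f_1]. *)
Lemma phi_twist_phi : phi R * tw (phi R) * e 4 ^+ 2 = e 2 ^+ 4.
Proof.
have h := phi_prod R; have := congr1 tw h; rewrite !(rmorphXn, rmorphM) /=.
have te k : ~~ odd k.+1 -> tw (e k.+1) = e k.+1.
  by move=> ok; rewrite /eu twist_dil -signr_odd (negbTE ok) expr0 twist1.
rewrite (te 3%N) // (te 1%N) // => ht.
apply: (mulfI (expf_neq0 6 (eu_neq0 R 2))).
transitivity ((phi R * (e 1 ^+ 2 * e 4 ^+ 2)) * (tw (phi R) * (tw (e 1) ^+ 2 * e 4 ^+ 2))); last first.
  by rewrite h ht; ring.
transitivity (phi R * tw (phi R) * e 4 ^+ 2 * (tw (e 1) * (e 1 * e 4)) ^+ 2); last by ring.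
by rewrite twist_euler; ring.
Qed.

Definition phi13 : series R := phi R * dil 3 (phi R).

Lemma phi13_prod : phi13 * (e 1 ^+ 2 * e 3 ^+ 2 * e 4 ^+ 2 * e 12 ^+ 2) = e 2 ^+ 5 * e 6 ^+ 5.
Proof.
have h := congr1 (dil 3) (phi_prod R); rewrite !(rmorphXn, rmorphM) /= !dil_eu in h.
by rewrite -h -phi_prod /phi13; ring.
Qed.

(** The formula for [F^2] with denominators cleared, proved in [q ^ 2] from
    [(a + b)^2 = (a - b)^2 + 4 a b] for [a = phi13] and [b] its image under [q |-> - q]. *)
Lemma phi13_even_sqr : even_part phi13 ^+ 2 * (e 1 ^+ 2 * e 2 ^+ 2 * e 3 ^+ 2 * e 6 ^+ 2)
  = 4 * q * e 2 ^+ 6 * e 6 ^+ 6 + e 1 ^+ 6 * e 3 ^+ 6.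
Proof.
apply: (@dil_inj _ 2); rewrite rmorphD !(rmorphXn, rmorphM) rmorph_nat /= !dil_eu dil_mono -[(2 * 1)%N]/2%N.
have -> : mono 1 2 = q ^+ 2 by rewrite monoX.
set F := dil 2 (even_part phi13).
have hF : phi13 + tw phi13 = 2 * F := even_part_eq phi13.
have hL : phi13 - tw phi13 = q * (dil 2 (theta_tri 1) * dil 6 (theta_tri 1)) := legendre R.
have h2 := congr1 (dil 2) (theta_tri1_prod R); have h6 := congr1 (dil 6) (theta_tri1_prod R).
rewrite !(rmorphXn, rmorphM) !rmorph_nat /= !dil_eu in h2 h6.
have hP : phi13 * tw phi13 * (e 4 ^+ 2 * e 12 ^+ 2) = e 2 ^+ 4 * e 6 ^+ 4.
  have h := phi_twist_phi; have := congr1 (dil 3) h; rewrite !(rmorphXn, rmorphM) /= !dil_eu => h3.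
  rewrite -h -h3 /phi13 twist_dil (_ : (-1) ^+ 3 = -1); first by ring.
  by rewrite -signr_odd expr1.
have nz : (4 : series R) != 0.
  by rewrite (_ : 4 = 2 ^+ 2) ?expf_neq0 ?two_series_neq0 //; ring.
have sq : (phi13 - tw phi13) ^+ 2 + 4 * (phi13 * tw phi13) = (2 * F) ^+ 2 by rewrite -hF; ring.
apply: (mulfI nz).
transitivity (((phi13 - tw phi13) ^+ 2 + 4 * (phi13 * tw phi13))
   * (e 2 ^+ 2 * e 4 ^+ 2 * e 6 ^+ 2 * e 12 ^+ 2)).
  by rewrite sq; ring.
rewrite hL.
transitivity (q ^+ 2 * (dil 2 (theta_tri 1) * e 2) ^+ 2 * (dil 6 (theta_tri 1) * e 6) ^+ 2
    * e 4 ^+ 2 * e 12 ^+ 2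
  + 4 * (phi13 * tw phi13 * (e 4 ^+ 2 * e 12 ^+ 2)) * e 2 ^+ 2 * e 6 ^+ 2); first by ring.
by rewrite h2 h6 hP; ring.
Qed.

(** Taken as hypotheses since their proofs require a primitive cube root of unity; over [rat] they
    come from the descent. *)
Hypotheses
  (cubic_sum : e 1 * e 2 ^+ 3 * e 3 ^+ 9 + q * e 1 ^+ 4 * e 6 ^+ 9 = e 2 ^+ 8 * e 3 ^+ 4 * e 6)
  (cubic_diff : e 2 ^+ 4 * e 3 ^+ 9 - 8 * q * e 1 ^+ 3 * e 2 * e 6 ^+ 9 = e 1 ^+ 8 * e 3 * e 6 ^+ 4).

(** This is [F psi = X - 2 Y] multiplied by [f_1^3 f_3^3 f_6^3]. *)
Lemma phi13_even : even_part phi13 * (e 1 ^+ 2 * e 2 ^+ 2 * e 3 ^+ 3 * e 6 ^+ 3)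
  = e 2 ^+ 3 * e 3 ^+ 9 - 2 * q * e 1 ^+ 3 * e 6 ^+ 9.
Proof.
set lhs := LHS; set rhs := RHS.
have : lhs ^+ 2 = rhs ^+ 2.
  transitivity (even_part phi13 ^+ 2 * (e 1 ^+ 2 * e 2 ^+ 2 * e 3 ^+ 2 * e 6 ^+ 2)
      * (e 1 ^+ 2 * e 2 ^+ 2 * e 3 ^+ 4 * e 6 ^+ 4)); first by rewrite /lhs; ring.
  rewrite phi13_even_sqr.
  (* This is [(X - 2 Y)^2 = 4 Y (X + Y) + X (X - 8 Y)], prepared for the two cubic identities. *)
  transitivity (4 * q * e 1 ^+ 2 * e 6 ^+ 9 * (e 2 ^+ 8 * e 3 ^+ 4 * e 6)
     + e 2 ^+ 2 * e 3 ^+ 9 * (e 1 ^+ 8 * e 3 * e 6 ^+ 4)); first by ring.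
  by rewrite -cubic_sum -cubic_diff /rhs; ring.
have q0 : q 0%N = 0 by [].
have phi0 : phi R 0%N = 1.
  have := congr1 (@^~ 0%N) (phi_prod R).
  by rewrite !(coef_mul0, coef_exp0) !eu0 !expr1n !mulr1.
have lhs0 : lhs 0%N = 1.
  rewrite /lhs !(coef_mul0, coef_exp0) !eu0 !expr1n !mulr1.
  by rewrite /even_part muln0 /phi13 coef_mul0 dil_coef0 phi0 mulr1.
have rhs0 : rhs 0%N = 1.
  rewrite /rhs coef_add coef_opp !(coef_mul0, coef_exp0) !eu0 !expr1n q0.
  by rewrite mulr0 !mul0r subr0 mulr1.
(* Both constant terms are 1, which excludes the opposite sign because [2 != 0]. *)
move/eqP; rewrite eqf_sqr => /orP[/eqP //|/eqP h].
have := congr1 (@^~ 0%N) h; rewrite coef_opp lhs0 rhs0 => /eqP.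
by rewrite -addr_eq0 -[1 + 1]/(2 : R) (negbTE two_neq0).
Qed.
End EvenPart.

Lemma cubic_sum_rat : eu rat 1 * eu rat 2 ^+ 3 * eu rat 3 ^+ 9
  + mono 1 1 * eu rat 1 ^+ 4 * eu rat 6 ^+ 9 = eu rat 2 ^+ 8 * eu rat 3 ^+ 4 * eu rat 6.
Proof.
have [w hw] := cube_root_unity.
by apply: (cubic_sum_descent (ratr : {rmorphism rat -> algC}) hw); rewrite pnatr_eq0.
Qed.
Lemma cubic_diff_rat : eu rat 2 ^+ 4 * eu rat 3 ^+ 9
  - 8 * mono 1 1 * eu rat 1 ^+ 3 * eu rat 2 * eu rat 6 ^+ 9 = eu rat 1 ^+ 8 * eu rat 3 * eu rat 6 ^+ 4.
Proof.
have [w hw] := cube_root_unity.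
exact: (cubic_diff_descent (ratr : {rmorphism rat -> algC}) hw).
Qed.

(** * Translation of the statement into the ring of series, and conclusion *)

Lemma finv_upto_size f n : size (finv_upto f n) = n.+1.
Proof. by elim: n => //= n IH; rewrite size_rcons IH. Qed.
Lemma finv_upto_nth f n m : (n <= m)%N -> nth 0 (finv_upto f m) n = Defs.finv f n.
Proof.
move=> nm; rewrite -(subnK nm); elim: (m - n)%N => // k IH.
by rewrite addSn /= nth_rcons finv_upto_size ltnS leq_addl IH.
Qed.
Lemma finvS f n : Defs.finv f n.+1 = - (f 0%N)^-1 * \sum_(i < n.+1) f i.+1 * Defs.finv f (n - i)%N.
Proof.
rewrite {1}/Defs.finv /= nth_rcons finv_upto_size ltnn eqxx; congr (_ * _).
by apply: eq_bigr => i _; rewrite finv_upto_nth ?leq_subr.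
Qed.
Lemma mul_finv (f : series rat) : f 0%N != 0 -> f * (Defs.finv f : series rat) = 1.
Proof.
move=> f0; apply/funext => -[|n]; first by rewrite coef_mul0 coef_one divff.
rewrite coef_mul big_ord_recl subn0 finvS mulrA mulrN divff // mulN1r coef_one /=.
by rewrite addrC; apply/eqP; rewrite subr_eq0; apply/eqP.
Qed.
Lemma fpowE (f : series rat) k : fpow f k = f ^+ k :> series rat.
Proof. by elim: k => // k IH; rewrite exprS -IH. Qed.
Lemma fscale_natE k (f : series rat) : fscale k%:R f = f *+ k :> series rat.
Proof.
apply/funext => n; rewrite /fscale mulr_natl.
by elim: k => // k IH; rewrite !mulrS coef_add IH.
Qed.

Theorem theorem2p6 :
  U (fmul (fdilate 2 gamma) (fpow delta 2)) =
  fadd (fscale 3%:R (fpow xi 2)) (fscale (- 2%:R) (fpow xi 3)).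
Proof.
pose e : nat -> series rat := eu rat.
have e0 k : e k 0%N = 1 by apply: eu0.
have en0 k : e k != 0 by apply: eu_neq0.
pose g : series rat := gamma; pose d : series rat := delta; pose x : series rat := xi.
have two0 : (2 : rat) != 0 by [].
(* The definitions of [gamma], [delta] and [xi] with denominators cleared; apart from powers, the
   translation is by conversion. *)
have hg : g * e 3%N ^+ 15 = e 1%N ^+ 5 * e 2%N ^+ 5 * e 6%N ^+ 5.
  have -> : g = e 1%N ^+ 5 * e 2%N ^+ 5 * e 6%N ^+ 5 * (Defs.finv (e 3%N ^+ 15) : series rat).
    by rewrite -!fpowE.
  by rewrite -mulrA [X in _ * X]mulrC mul_finv ?mulr1 // coef_exp0 e0 expr1n.
have hd : d * (e 1%N * e 3%N * e 12%N) = e 4%N * e 6%N ^+ 2.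
  have -> : d = e 4%N * e 6%N ^+ 2 * (Defs.finv (e 1%N * e 3%N * e 12%N) : series rat).
    by rewrite -!fpowE.
  by rewrite -mulrA [X in _ * X]mulrC mul_finv ?mulr1 // !coef_mul0 !e0 !mulr1.
have hx : x * (e 1%N * e 3%N ^+ 5) = e 2%N ^+ 5 * e 6%N.
  have -> : x = e 2%N ^+ 5 * e 6%N * (Defs.finv (e 1%N * e 3%N ^+ 5) : series rat).
    by rewrite -!fpowE.
  by rewrite -mulrA [X in _ * X]mulrC mul_finv ?mulr1 // coef_mul0 coef_exp0 !e0 expr1n mulr1.
have -> : U (fmul (fdilate 2 gamma) (fpow delta 2)) = even_part (dil 2 g * d ^+ 2).
  by rewrite -fpowE.
have -> : fadd (fscale 3%:R (fpow xi 2)) (fscale (- 2%:R) (fpow xi 3)) = x ^+ 2 *+ 3 - x ^+ 3 *+ 2.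
  rewrite -!fscale_natE -!fpowE; apply/funext => n; rewrite coef_add coef_opp.
  by rewrite /fadd /fscale mulNr.
rewrite even_partM //; set F := even_part (phi13 rat).
(* From [delta^2 = f_4^4 / (f_2^5 f_6) * phi13]: the quotient is a series in [q ^ 2] and passes
   through the even part. *)
have hD : e 1%N ^+ 5 * e 3%N * even_part (d ^+ 2) = e 2%N ^+ 4 * F.
  rewrite -!even_partM // !(rmorphXn, rmorphM) /= !dil_eu; congr even_part.
  apply: (mulfI (expf_neq0 4 (en0 6%N))).
  transitivity (d ^+ 2 * (e 2%N ^+ 5 * e 6%N ^+ 5)); first by rewrite /e; ring.
  rewrite /e -phi13_prod -/e.
  transitivity (phi13 rat * e 4%N ^+ 2 * (d * (e 1%N * e 3%N * e 12%N)) ^+ 2); first by ring.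
  by rewrite hd; rewrite /e; ring.
have hF := phi13_even two0 cubic_sum_rat cubic_diff_rat; rewrite -/F -/e in hF.
(* The smallest product of powers of [f_1] and [f_3] that makes room for [hg], [hD] and the factor
   [f_3^3] of [hF]. *)
have nz : e 1%N ^+ 8 * e 3%N ^+ 19 != 0 by rewrite mulf_neq0 ?expf_neq0.
apply: (mulfI nz).
transitivity (g * e 3%N ^+ 15 * (e 1%N ^+ 5 * e 3%N * even_part (d ^+ 2)) * e 1%N ^+ 3 * e 3%N ^+ 3).
  by ring.
rewrite hg hD.
transitivity (F * (e 1%N ^+ 2 * e 2%N ^+ 2 * e 3%N ^+ 3 * e 6%N ^+ 3) *
  (e 1%N ^+ 6 * e 2%N ^+ 7 * e 6%N ^+ 2)); first by ring.
rewrite hF.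
transitivity (3 * (x * (e 1%N * e 3%N ^+ 5)) ^+ 2 * e 1%N ^+ 6 * e 3%N ^+ 9
  - 2 * (x * (e 1%N * e 3%N ^+ 5)) ^+ 3 * e 1%N ^+ 5 * e 3%N ^+ 4); last by ring.
rewrite hx.
(* Up to a common factor [xi^2] is [X] and [xi^3] is [X + Y], so the claim becomes
   [X - 2 Y = 3 X - 2 (X + Y)]. *)
transitivity (3 * (e 2%N ^+ 5 * e 6%N) ^+ 2 * e 1%N ^+ 6 * e 3%N ^+ 9
  - 2 * (e 2%N ^+ 8 * e 3%N ^+ 4 * e 6%N) * e 2%N ^+ 7 * e 6%N ^+ 2 * e 1%N ^+ 5); last by ring.
by rewrite /e -cubic_sum_rat -/e; ring.
Qed.
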